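(* For any $w\in\widehat{\mathfrak{H}^{0}}$ it holds that $Z_\omega(\sigma(w))=Z_\omega(w)$.
   Context: Let $\hbar$ be a formal variable, $\mathcal{C}=\mathbb{Q}[\hbar]$ and $\mathfrak{H}=\mathcal{C}\langle a,b\rangle$ the non-commutative polynomial ring in $a,b$. For $k\ge 1$ put $g_k=ba^k$ and $e_k=b(a+\hbar)a^{k-1}$; thus $e_1-g_1=\hbar b$. Let $\mathcal{A}=\{\hbar b\}\cup\{ba^k\mid k\ge 1\}$. Let $\mathcal{M}_0$ be the set consisting of $1$ and all elements $(e_1-g_1)^{\alpha_1}g_{\beta_1+1}\cdots(e_1-g_1)^{\alpha_r}g_{\beta_r+1}$ with $r\ge1$, $\alpha_j,\beta_j\ge 0$ (i.e. words in $\mathcal A$ whose rightmost letter is not $e_1-g_1$), and $\widehat{\mathfrak{H}^{0}}$ the $\mathcal{C}$-span of $\mathcal{M}_0$. Let $\sigma$ be the anti-involution of $\mathbb{Q}[\hbar,\hbar^{-1}]\otimes_{\mathcal C}\mathfrak H$ which is $\mathbb Q[\hbar,\hbar^{-1}]$-linear, reverses products, and satisfies $\sigma(a)=\hbar b$, $\sigma(b)=\hbar^{-1}a$. Then $\sigma\big((e_1-g_1)^{\alpha_1}g_{\beta_1+1}\cdots(e_1-g_1)^{\alpha_r}g_{\beta_r+1}\big)=(e_1-g_1)^{\beta_r}g_{\alpha_r+1}\cdots(e_1-g_1)^{\beta_1}g_{\alpha_1+1}$, so $\sigma$ restricts to a $\mathcal C$-linear automorphism of $\widehat{\mathfrak{H}^{0}}$.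 Fix $0<\omega<2$ and let $\hbar$ act on $\mathbb C$ (and on functions into $\mathbb C$) as multiplication by $2\pi i\omega$. Define the $\mathcal{C}$-linear map $I_\omega(\cdot\,|\,t)$ on the $\mathcal C$-span of $\mathcal A$ by $I_\omega(e_1-g_1\,|\,t)=2\pi i\omega$ and $I_\omega(g_k\,|\,t)=\left(\frac{2\pi i\omega}{e^{-2\pi i\omega t}-1}\right)^k$ ($k\ge1$). Define the $\mathcal{C}$-linear map $Z_\omega:\widehat{\mathfrak{H}^{0}}\to\mathbb{C}$ by $Z_\omega(1)=1$ and, for $u_1,\dots,u_r\in\mathcal A$ with $u_r\neq e_1-g_1$, \[ Z_\omega(u_1\cdots u_r)=\prod_{a=1}^r\int_{-\epsilon+i\mathbb R}\frac{dt_a}{e^{2\pi i t_a}-1}\prod_{a=1}^r I_\omega(u_a\,|\,t_1+\cdots+t_a), \] where $0<\epsilon<\min(1,1/(r\omega))$ (absolutely convergent and independent of $\epsilon$). *)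

(* Defs.v *)
From HB Require Import structures.
From mathcomp Require Import all_boot all_order all_algebra.
From mathcomp Require Import finmap.
From mathcomp Require Import all_classical all_reals all_analysis.
From mathcomp Require Import complex.
(* The notations of monalg clash with those of MathComp-Analysis. *)
From mathcomp Require Import -(notations) monalg.

Set Implicit Arguments.
Unset Strict Implicit.
Unset Printing Implicit Defensive.

Import Order.TTheory GRing.Theory Num.Theory.

Local Open Scope ring_scope.
Local Open Scope complex_scope.

Local Notation tofrac := (@FracField.tofrac {poly rat}).

(* The ring Q[hbar, hbar^-1], realised inside the field Q(hbar); the variable
   hbar is 'X. *)
Definition laurent_pred : {pred {fraction {poly rat}}} :=
  fun x => `[< exists (n : nat) (p : {poly rat}), x = tofrac p / tofrac 'X ^+ n >].

Lemma tofracX_neq0 n : tofrac 'X ^+ n != 0.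
Proof. by rewrite expf_neq0 // tofrac_eq0 polyX_eq0. Qed.

Lemma laurent_subring_closed : subring_closed laurent_pred.
Proof.
split.
- by apply/asboolP; exists 0%N, 1; rewrite expr0 divr1 rmorph1.
- move=> _ _ /asboolP[n [p ->]] /asboolP[m [q ->]]; apply/asboolP.
  exists (n + m)%N, (p * 'X^m - q * 'X^n).
  rewrite rmorphB !rmorphM !rmorphXn exprD mulrBl.
  have /= hn := tofracX_neq0 n; have /= hm := tofracX_neq0 m.
  congr (_ - _); first by rewrite -mulf_div divff // mulr1.
  by rewrite [tofrac 'X ^+ n * tofrac 'X ^+ m]mulrC -mulf_div divff // mulr1.
- move=> _ _ /asboolP[n [p ->]] /asboolP[m [q ->]]; apply/asboolP.
  exists (n + m)%N, (p * q).
  by rewrite rmorphM exprD -mulf_div.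
Qed.

HB.instance Definition _ :=
  GRing.isSubringClosed.Build {fraction {poly rat}} laurent_pred
    laurent_subring_closed.

Record laurent := Laurent {
  laurent_val :> {fraction {poly rat}};
  _ : laurent_val \in laurent_pred
}.

HB.instance Definition _ := [isSub for laurent_val].
HB.instance Definition _ := [Choice of laurent by <:].
HB.instance Definition _ := [SubChoice_isSubComNzRing of laurent by <:].

Lemma laurent_poly_subproof (p : {poly rat}) : tofrac p \in laurent_pred.
Proof. by apply/asboolP; exists 0%N, p; rewrite expr0 divr1. Qed.

Definition laurent_poly (p : {poly rat}) : laurent :=
  Laurent (laurent_poly_subproof p).

Lemma laurent_hinv_subproof : (tofrac 'X)^-1 \in laurent_pred.
Proof. by apply/asboolP; exists 1%N, 1; rewrite expr1 rmorph1 div1r. Qed.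

Definition laurent_hinv : laurent := Laurent laurent_hinv_subproof.

Lemma laurent_poly_is_zmod_morphism : zmod_morphism laurent_poly.
Proof. by move=> p q; apply: val_inj; rewrite /= rmorphB. Qed.

Lemma laurent_poly_is_monoid_morphism : monoid_morphism laurent_poly.
Proof.
split; first by apply: val_inj; rewrite /= rmorph1.
by move=> p q; apply: val_inj; rewrite /= rmorphM.
Qed.

HB.instance Definition _ :=
  GRing.isZmodMorphism.Build {poly rat} laurent laurent_poly
    laurent_poly_is_zmod_morphism.
HB.instance Definition _ :=
  GRing.isMonoidMorphism.Build {poly rat} laurent laurent_poly
    laurent_poly_is_monoid_morphism.

Lemma laurent_poly_inj : injective laurent_poly.
Proof.
by move=> p q /(congr1 val) /= /eqP; rewrite tofrac_eq => /eqP.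
Qed.

Lemma laurent_hinvK : laurent_poly 'X * laurent_hinv = 1.
Proof.
by apply: val_inj; rewrite /= divff // -[tofrac _]expr1 tofracX_neq0.
Qed.

(* The free algebra K<a, b> is the algebra over K of the free monoid on bool,
   where false stands for a and true for b. *)
Notation free_alg K := (malg (fmonom bool) K).
Notation frakH := (free_alg {poly rat}).
Notation frakH_laurent := (free_alg laurent).

Definition va {K : nzRingType} : free_alg K := mkmalgU (fmu false) 1.
Definition vb {K : nzRingType} : free_alg K := mkmalgU (fmu true) 1.

Definition e_ (k : nat) : frakH := vb * (va + 'X *: 1) * va ^+ k.-1.
Definition g_ (k : nat) : frakH := vb * va ^+ k.

(* The alphabet A is indexed by nat: letter 0 = hbar b, letter k = b a ^ k for
   k >= 1. *)
Definition letter (k : nat) : frakH := if k is 0 then e_ 1 - g_ 1 else g_ k.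

Definition M0_elt (s : seq (nat * nat)) : frakH :=
  \prod_(p <- s) ((e_ 1 - g_ 1) ^+ p.1 * g_ p.2.+1).

Definition M0 : set frakH := [set x | exists s, x = M0_elt s].

Definition hatH0 : set frakH :=
  [set w | exists2 s : seq ({poly rat} * frakH),
     (forall c, c \in s -> M0 c.2) & w = \sum_(c <- s) c.1 *: c.2].

(* The embedding of H into Q[hbar, hbar^-1] (x) H. *)
Definition extend (w : frakH) : frakH_laurent :=
  \sum_(m <- msupp w) laurent_poly (mcoeff m w) *: mkmalgU m 1.

Definition sigma_gen (x : bool) : frakH_laurent :=
  if x then laurent_hinv *: va else laurent_poly 'X *: vb.

Definition sigma (w : frakH_laurent) : frakH_laurent :=
  \sum_(m <- msupp w) mcoeff m w *: \prod_(x <- rev m) sigma_gen x.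

(* The restriction of sigma to elements w of H with sigma(w) in H (0 for the
   other elements of H); see sigmaH_hatH0. *)
Definition sigmaH (w : frakH) : frakH :=
  xget 0 [set w' | extend w' = sigma (extend w)].

Definition cexp {R : realType} (z : R[i]) : R[i] :=
  (expR (complex.Re z) * cos (complex.Im z)) +i*
  (expR (complex.Re z) * sin (complex.Im z)).

Definition cintegral {R : realType} (f : R -> R[i]) : R[i] :=
  (\int[@lebesgue_measure R]_(x in setT) complex.Re (f x))%R +i*
  (\int[@lebesgue_measure R]_(x in setT) complex.Im (f x))%R.

(* The integral along - eps + i R, oriented upwards: t = - eps + i x and
   dt = i dx. *)
Definition line_integral {R : realType} (eps : R) (f : R[i] -> R[i]) : R[i] :=
  (0 +i* 1) * cintegral (fun x => f ((- eps) +i* x)).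

(* The r-fold iterated integral of F [:: t_1; ...; t_r], the integral over t_1
   being the outermost one. *)
Fixpoint multi_integral {R : realType} (eps : R) (r : nat)
    (F : seq R[i] -> R[i]) : R[i] :=
  if r is r'.+1 then
    line_integral eps (fun t => multi_integral eps r' (fun ts => F (t :: ts)))
  else F [::].

Definition two_pi_i {R : realType} : R[i] := 0 +i* (2 * pi).

(* I_omega on the letters. *)
Definition I_ {R : realType} (omega : R) (k : nat) (t : R[i]) : R[i] :=
  if k is 0 then two_pi_i * omega%:C
  else (two_pi_i * omega%:C / (cexp (- (two_pi_i * omega%:C * t)) - 1)) ^+ k.

(* Z_omega(u_1 ... u_r) for the word u = [:: u_1; ...; u_r] of letters; eps r
   is the chosen contour parameter for words of length r. *)
Definition Z_word {R : realType} (eps : nat -> R) (omega : R) (u : seq nat) :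
    R[i] :=
  let r := size u in
  multi_integral (eps r) r (fun t =>
    (\prod_(j < r) (cexp (two_pi_i * t`_j) - 1)^-1) *
    (\prod_(j < r) I_ omega (nth 0%N u j) (\sum_(l < j.+1) t`_l))).

(* The action of C on the complex numbers, hbar acting as 2 pi i omega. *)
Definition eval_hbar {R : realType} (omega : R) (p : {poly rat}) : R[i] :=
  (map_poly ratr p).[two_pi_i * omega%:C].

(* blocks sends the monomial b a^k_1 ... b a^k_r to [:: k_1; ...; k_r]. *)
Definition blocks (m : seq bool) : seq nat :=
  (foldr (fun (x : bool) (p : nat * seq nat) =>
            if x then (0%N, p.1 :: p.2) else (p.1.+1, p.2)) (0%N, [::]) m).2.

(* The monomial b a^k_1 ... b a^k_r is hbar ^- n times the word
   letter k_1 ... letter k_r, where n is the number of j with k_j = 0; hence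
   the division by (2 pi i omega) ^ n.  By Z_omega_is_linear and
   Z_omega_letters, Z_omega is the C-linear map with the values Z_word on the
   words in the alphabet A; only its values on hatH0 matter. *)
Definition Z_omega {R : realType} (eps : nat -> R) (omega : R) (w : frakH) : R[i] :=
  \sum_(m <- msupp w)
    eval_hbar omega (mcoeff m w)
      / (two_pi_i * omega%:C) ^+ count_mem 0%N (blocks m)
      * Z_word eps omega (blocks m).

Lemma extendE w :
  extend w = mmap (mkmalgU one \o laurent_poly) (fun m => mkmalgU m 1) w.
Proof. by apply: eq_bigr => m _ /=; rewrite mul_malgC. Qed.

Lemma extend_is_zmod_morphism : zmod_morphism extend.
Proof. by move=> x y; rewrite !extendE raddfB. Qed.

HB.instance Definition _ :=
  GRing.isZmodMorphism.Build frakH frakH_laurent extend extend_is_zmod_morphism.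

Lemma extendU m c : extend (mkmalgU m c) = mkmalgU m (laurent_poly c).
Proof. by rewrite extendE mmapU /= malgM_def fgmulUU mulr1 mul1m. Qed.

Lemma extend_sum w :
  extend w = \sum_(m <- msupp w) mkmalgU m (laurent_poly (mcoeff m w)).
Proof.
rewrite [w in LHS]monalgE raddf_sum.
by apply: eq_bigr => m _; exact: extendU.
Qed.

Lemma extend0 : extend 0 = 0. Proof. exact: raddf0. Qed.

Lemma extend_is_monoid_morphism : monoid_morphism extend.
Proof.
split; first by rewrite extendU rmorph1.
move=> x y; rewrite malgME raddf_sum (extend_sum x) (extend_sum y) mulr_suml.
apply: eq_bigr => i _; rewrite mulr_sumr raddf_sum; apply: eq_bigr => j _ /=.
by rewrite extendU malgM_def fgmulUU rmorphM.
Qed.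

HB.instance Definition _ :=
  GRing.isMonoidMorphism.Build frakH frakH_laurent extend
    extend_is_monoid_morphism.

Lemma extendD x y : extend (x + y) = extend x + extend y.
Proof. exact: raddfD. Qed.

Lemma extendM x y : extend (x * y) = extend x * extend y.
Proof. exact: rmorphM. Qed.

Lemma extendX x n : extend (x ^+ n) = extend x ^+ n.
Proof. exact: rmorphXn. Qed.

Lemma extendZ c w : extend (c *: w) = laurent_poly c *: extend w.
Proof.
by rewrite -!mul_malgC rmorphM /= extendU.
Qed.

Lemma mcoeff_extend w m : mcoeff m (extend w) = laurent_poly (mcoeff m w).
Proof.
rewrite [w in LHS]monalgE [w in RHS]monalgE.
rewrite [extend _]raddf_sum [mcoeff m _ in LHS]raddf_sum.
rewrite [mcoeff m _ in RHS]raddf_sum [RHS]raddf_sum.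
by apply: eq_bigr => i _ /=; rewrite extendU !mcoeffU rmorphMn.
Qed.

Lemma extend_inj : injective extend.
Proof.
move=> x y exy; apply/malgP => m; apply: laurent_poly_inj.
by rewrite -!mcoeff_extend exy.
Qed.

Lemma sigmaE w :
  sigma w = mmap (mkmalgU one) (fun m : fmonom bool => \prod_(x <- rev m) sigma_gen x) w.
Proof. by apply: eq_bigr => m _ /=; rewrite mul_malgC. Qed.

Lemma sigma_is_zmod_morphism : zmod_morphism sigma.
Proof. by move=> x y; rewrite !sigmaE raddfB. Qed.

HB.instance Definition _ :=
  GRing.isZmodMorphism.Build frakH_laurent frakH_laurent sigma
    sigma_is_zmod_morphism.

Lemma sigmaU m c :
  sigma (mkmalgU m c) = c *: \prod_(x <- rev m) sigma_gen x.
Proof. by rewrite sigmaE mmapU mul_malgC. Qed.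

Lemma sigma_sum w : sigma w =
  \sum_(m <- msupp w) mcoeff m w *: \prod_(x <- rev m) sigma_gen x.
Proof. by []. Qed.

Lemma sigma0 : sigma 0 = 0. Proof. exact: raddf0. Qed.

Lemma sigma1 : sigma 1 = 1.
Proof. by rewrite sigmaU scale1r fm1 big_nil. Qed.

Lemma sigma_a : sigma va = laurent_poly 'X *: vb.
Proof. by rewrite sigmaU scale1r fmU big_seq1. Qed.

Lemma sigma_b : sigma vb = laurent_hinv *: va.
Proof. by rewrite sigmaU scale1r fmU big_seq1. Qed.

Lemma malg_scalerAr (K : monomType) (R : comNzRingType) (c : R)
    (x y : malg K R) : x * (c *: y) = c *: (x * y).
Proof.
rewrite -!mul_malgC !mulrA; congr (_ * y).
rewrite [x]monalgE mulr_suml mulr_sumr; apply: eq_bigr => i _.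
by rewrite !malgM_def !fgmulUU mulrC mulm1 mul1m.
Qed.

Lemma scale_mkmalgU (K : monomType) (R : nzRingType) (c : R) (m : K) :
  c *: (mkmalgU m 1) = mkmalgU m c.
Proof. by rewrite -mul_malgC malgM_def fgmulUU mulr1 mul1m. Qed.

Lemma sigmaD x y : sigma (x + y) = sigma x + sigma y.
Proof. exact: raddfD. Qed.

Lemma sigmaM x y : sigma (x * y) = sigma y * sigma x.
Proof.
rewrite malgME raddf_sum (sigma_sum x) (sigma_sum y) mulr_sumr.
apply: eq_bigr => i _; rewrite mulr_suml raddf_sum; apply: eq_bigr => j _.
by rewrite [LHS]sigmaU fmM rev_cat big_cat -scalerAl malg_scalerAr scalerA mulrC.
Qed.

Lemma sigmaZ c w : sigma (c *: w) = c *: sigma w.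
Proof. by rewrite -mul_malgC sigmaM sigmaU fm1 big_nil malg_scalerAr mulr1. Qed.

Lemma sigmaX x n : sigma (x ^+ n) = sigma x ^+ n.
Proof.
by elim: n => [|n ih]; rewrite ?sigma1 // exprS sigmaM ih -exprSr.
Qed.

Lemma sigma_invol : involutive sigma.
Proof.
have si x : sigma (sigma_gen x) = mkmalgU (fmu x) 1.
  rewrite /sigma_gen; case: x; rewrite sigmaZ ?(sigma_a, sigma_b) scalerA.
    by rewrite mulrC laurent_hinvK scale1r.
  by rewrite laurent_hinvK scale1r.
move=> w; rewrite [RHS]monalgE.
have -> : sigma (sigma w) =
    \sum_(m <- msupp w) sigma (sigma (mkmalgU m (mcoeff m w))).
  by rewrite -!raddf_sum -monalgE.
apply: eq_bigr => -[m] _ /=; rewrite sigmaU sigmaZ /=.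
rewrite -[in RHS]scale_mkmalgU; congr (_ *: _).
elim: m => [|x m ih] /=; first by rewrite /rev /= big_nil sigma1;
    congr (mkmalgU _ _); apply/val_inj; rewrite /= fm1.
rewrite rev_cons big_rcons /= sigmaM ih si malgM_def fgmulUU mulr1.
by congr (mkmalgU _ _); apply/val_inj; rewrite /= fmM fmU.
Qed.

Lemma e_subg : e_ 1 - g_ 1 = 'X *: vb.
Proof.
by rewrite /e_ /g_ expr0 mulr1 expr1 mulrDr addrC addKr malg_scalerAr mulr1.
Qed.

Lemma extend_va : extend va = va. Proof. by rewrite extendU rmorph1. Qed.

Lemma extend_vb : extend vb = vb. Proof. by rewrite extendU rmorph1. Qed.

Lemma sigma_e_subg : sigma (extend (e_ 1 - g_ 1)) = va.
Proof.
by rewrite e_subg extendZ extend_vb sigmaZ sigma_b scalerA laurent_hinvK scale1r.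
Qed.

Lemma extend_g k : extend (g_ k) = vb * va ^+ k.
Proof. by rewrite rmorphM rmorphXn /= extend_vb extend_va. Qed.

Lemma M0_elt_nil : M0_elt [::] = 1. Proof. exact: big_nil. Qed.

Lemma M0_elt_cons p s :
  M0_elt (p :: s) = (e_ 1 - g_ 1) ^+ p.1 * g_ p.2.+1 * M0_elt s.
Proof. exact: big_cons. Qed.

Lemma M0_elt_rcons p s :
  M0_elt (rcons s p) = M0_elt s * ((e_ 1 - g_ 1) ^+ p.1 * g_ p.2.+1).
Proof. exact: big_rcons. Qed.

Lemma sigma_g k : sigma (extend (g_ k)) =
  (laurent_poly 'X *: vb) ^+ k * (laurent_hinv *: va).
Proof.
rewrite extend_g sigmaM sigma_b; congr (_ * _).
by rewrite sigmaX sigma_a.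
Qed.

Lemma exp_swap (A : nzRingType) (x y a b : A) n m : x * y = b * a ->
  x ^+ n.+1 * y * a ^+ m = x ^+ n * (b * a ^+ m.+1).
Proof. by move=> xy; rewrite exprSr exprS -mulrA -!mulrA (mulrA x) xy -mulrA. Qed.

Lemma sigma_block al be :
  sigma (extend ((e_ 1 - g_ 1) ^+ al * g_ be.+1))
  = extend ((e_ 1 - g_ 1) ^+ be * g_ al.+1).
Proof.
have hl : sigma (extend (e_ 1 - g_ 1) ^+ al) = va ^+ al.
  by rewrite sigmaX sigma_e_subg.
have hr : extend ((e_ 1 - g_ 1) ^+ be) = (laurent_poly 'X *: vb) ^+ be.
  by rewrite extendX e_subg extendZ extend_vb.
rewrite [in LHS]extendM [in LHS]sigmaM [in RHS]extendM [in LHS]extendX.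
rewrite [in LHS]sigma_g.
rewrite hl.
rewrite hr.
rewrite [in RHS]extend_g.
apply: exp_swap.
by rewrite -scalerAl malg_scalerAr scalerA laurent_hinvK scale1r.
Qed.

(* sigma exchanges the alpha_j and the beta_j and reverses their order. *)
Lemma sigma_M0_elt s :
  sigma (extend (M0_elt s)) = extend (M0_elt (rev [seq (p.2, p.1) | p <- s])).
Proof.
elim: s => [|[al be] s ih]; first by rewrite M0_elt_nil rmorph1 sigma1.
rewrite map_cons rev_cons M0_elt_cons M0_elt_rcons.
rewrite [in LHS]extendM [in RHS]extendM [in LHS]sigmaM.
exact: (congr2 *%R ih (sigma_block al be)).
Qed.

Lemma sigmaH_hatH0 w : hatH0 w ->
  hatH0 (sigmaH w) /\ extend (sigmaH w) = sigma (extend w).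
Proof.
case=> s sM ->{w}.
have [s' s'M es'] : exists2 s' : seq ({poly rat} * frakH),
    (forall c, c \in s' -> M0 c.2) &
    extend (\sum_(c <- s') c.1 *: c.2)
      = sigma (extend (\sum_(c <- s) c.1 *: c.2)).
  elim: s sM => [|[c x] s ih] sM.
    by exists [::]; [move=> c | rewrite !big_nil extend0 sigma0].
  have [|s' s'M es'] := ih; first by move=> d ds; apply: sM; rewrite inE ds orbT.
  have [t /= ->] := sM (c, x) (mem_head _ _).
  exists ((c, M0_elt (rev [seq (p.2, p.1) | p <- t])) :: s').
    move=> d; rewrite inE => /orP[/eqP->|ds]; last exact: s'M.
    by exists (rev [seq (p.2, p.1) | p <- t]).
  rewrite [in LHS]big_cons [in RHS]big_cons.
  rewrite [in LHS]extendD [in RHS]extendD [in RHS]sigmaD.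
  apply: (congr2 +%R _ es'); rewrite [in LHS]extendZ [in RHS]extendZ [in RHS]sigmaZ.
  exact: (congr1 _ (esym (sigma_M0_elt t))).
have : extend (sigmaH (\sum_(c <- s) c.1 *: c.2))
    = sigma (extend (\sum_(c <- s) c.1 *: c.2)).
  by apply: (@xgetI _ 0 [set w' | extend w' = _] _ es').
move=> es; have hs := extend_inj (etrans es (esym es')).
split; last exact: es.
exists s'; last exact: hs.
exact: s'M.
Qed.

(* M0 is the set of words in the alphabet not ending with e_1 - g_1. *)
Lemma M0P x : M0 x <->
  exists2 u, last 1%N u != 0%N & x = \prod_(k <- u) letter k.
Proof.
split=> [[s ->{x}]|[u u0 ->{x}]].
  elim: s => [|[al be] s [u u0 ih]].
    by exists [::] => //; rewrite big_nil; exact: M0_elt_nil.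
  exists ((rcons (nseq al 0%N) be.+1) ++ u).
    by rewrite last_cat last_rcons; case: u u0 {ih}.
  rewrite M0_elt_cons big_cat big_rcons big_nseq iter_mulr_1 /=.
  exact: (congr1 (fun z => _ * z) ih).
have key k v : last k v != 0%N -> exists al be s,
    \prod_(l <- k :: v) letter l = M0_elt ((al, be) :: s).
  elim: v k => [|l v ih] k.
    case: k => // k _; exists 0%N, k, [::].
    by rewrite big_seq1 M0_elt_cons M0_elt_nil expr0 mul1r mulr1.
  move=> /ih[al [be [s es]]]; rewrite big_cons es; case: k => [|k].
    exists al.+1, be, s; rewrite [in LHS]M0_elt_cons [in RHS]M0_elt_cons.
    by rewrite exprS /letter [in LHS]mulrA [in LHS]mulrA.
  exists 0%N, k, ((al, be) :: s).
  by rewrite [in RHS]M0_elt_cons expr0 mul1r.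
case: u u0 => [|k u] u0; first by exists [::]; rewrite big_nil M0_elt_nil.
by have [al [be [s ->]]] := key k u u0; exists ((al, be) :: s).
Qed.

Lemma eval_hbar_is_zmod_morphism (R : realType) (omega : R) :
  zmod_morphism (eval_hbar omega).
Proof. by move=> p q; rewrite /eval_hbar rmorphB hornerD hornerN. Qed.

Lemma eval_hbar_is_monoid_morphism (R : realType) (omega : R) :
  monoid_morphism (eval_hbar omega).
Proof.
split; first by rewrite /eval_hbar rmorph1 hornerC.
by move=> p q; rewrite /eval_hbar rmorphM hornerM.
Qed.

HB.instance Definition _ (R : realType) (omega : R) :=
  GRing.isZmodMorphism.Build {poly rat} R[i] (eval_hbar omega)
    (eval_hbar_is_zmod_morphism omega).
HB.instance Definition _ (R : realType) (omega : R) :=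
  GRing.isMonoidMorphism.Build {poly rat} R[i] (eval_hbar omega)
    (eval_hbar_is_monoid_morphism omega).

Lemma eval_hbarX (R : realType) (omega : R) :
  eval_hbar omega 'X = two_pi_i * omega%:C.
Proof. by rewrite /eval_hbar map_polyX hornerX. Qed.

Lemma two_pi_i_omega_neq0 (R : realType) (omega : R) :
  omega != 0 -> two_pi_i * omega%:C != 0.
Proof.
move=> om0; rewrite mulf_neq0 // eq_complex /= negb_and ?om0 //.
by rewrite mulf_neq0 ?orbT // gt_eqF // pi_gt0.
Qed.

Lemma Z_omegaE (R : realType) (eps : nat -> R) omega w : Z_omega eps omega w =
  mmap (eval_hbar omega) (fun m : fmonom bool =>
    ((two_pi_i * omega%:C) ^+ count_mem 0%N (blocks m))^-1
      * Z_word eps omega (blocks m)) w.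
Proof. by apply: eq_bigr => m _; rewrite mulrA. Qed.

Lemma Z_omega_is_linear (R : realType) (eps : nat -> R) omega (c : {poly rat})
    (x y : frakH) :
  Z_omega eps omega (c *: x + y)
    = eval_hbar omega c * Z_omega eps omega x + Z_omega eps omega y.
Proof.
rewrite !Z_omegaE raddfD /=; congr (_ + _).
rewrite (mmapEw (msuppZ_le c x)) mulr_sumr; apply: eq_bigr => m _.
have evM p q : eval_hbar omega (p * q) = eval_hbar omega p * eval_hbar omega q.
  exact: rmorphM.
by rewrite mcoeffZ /= evM -[LHS]mulrA.
Qed.

Definition word_monom (u : seq nat) : fmonom bool :=
  FMonom (flatten [seq true :: nseq k false | k <- u]).

Lemma blocks_word_monom u : blocks (word_monom u) = u.
Proof.
rewrite /blocks /word_monom /=; set F := foldr _ _.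
have Fa k s : F (nseq k false ++ s) = ((F s).1 + k, (F s).2)%N.
  by elim: k => [|k ih] /=; [rewrite addn0; case: (F s) | rewrite ih addnS].
suff -> : F (flatten [seq true :: nseq k false | k <- u]) = (0%N, u) by [].
by elim: u => //= k u ih; rewrite Fa ih.
Qed.

Lemma letterE k :
  letter k = 'X ^+ (k == 0%N) *: mkmalgU (FMonom (true :: nseq k false)) 1.
Proof.
have va_exp n : va ^+ n = mkmalgU (FMonom (nseq n false)) 1 :> frakH.
  elim: n => [|n ih].
    by rewrite expr0; congr (mkmalgU _ _); apply/val_inj; rewrite /= fm1.
  rewrite exprS ih malgM_def fgmulUU mulr1; congr (mkmalgU _ _).
  by apply/val_inj; rewrite /= fmM fmU.
case: k => [|k]; rewrite /letter.
  by rewrite e_subg; congr (_ *: mkmalgU _ _); apply/val_inj; rewrite /= fmU.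
rewrite scale1r /g_ va_exp malgM_def fgmulUU mulr1; congr (mkmalgU _ _).
by apply/val_inj; rewrite /= fmM fmU.
Qed.

Lemma prod_letterE u : \prod_(k <- u) letter k
  = 'X ^+ count_mem 0%N u *: mkmalgU (word_monom u) 1.
Proof.
elim: u => [|k u ih].
  rewrite big_nil scale1r; congr (mkmalgU _ _); apply/val_inj.
  by rewrite /= fm1.
rewrite big_cons ih letterE -scalerAl malg_scalerAr scalerA -exprD /=.
congr (_ *: _); rewrite malgM_def fgmulUU mulr1; congr (mkmalgU _ _).
by apply/val_inj; rewrite /= fmM.
Qed.

Lemma Z_omega_letters (R : realType) (eps : nat -> R) omega u : omega != 0 ->
  Z_omega eps omega (\prod_(k <- u) letter k) = Z_word eps omega u.
Proof.
move=> om0; rewrite prod_letterE scale_mkmalgU Z_omegaE mmapU blocks_word_monom.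
rewrite /= rmorphXn /= eval_hbarX mulrA mulfV ?mul1r //.
by rewrite expf_neq0 // two_pi_i_omega_neq0.
Qed.

Lemma Z_omega_1 (R : realType) (eps : nat -> R) omega : omega != 0 ->
  Z_omega eps omega 1 = 1.
Proof.
move=> om0; have := Z_omega_letters eps [::] om0; rewrite big_nil => ->.
by rewrite /Z_word /= !big_ord0 mulr1.
Qed.

(* Main.v *)
Require Import Defs.
From mathcomp Require Import all_boot all_order all_algebra.
From mathcomp Require Import all_classical all_reals all_analysis.
From mathcomp Require Import measurable_realfun complex.
From mathcomp Require Import -(notations) monalg.
From mathcomp Require Import ring lra.

(* A letter hbar b or b a ^ k contributes one convolution with
   1 / (exp (2 pi i t) - 1) along the contour, followed by k multiplications by
   1 / (exp (- hbar s) - 1).  Hence Z_omega of a word is obtained by reading its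
   monomial in b (convolution) and a (multiplication) as a composite operator,
   applying it to the constant 1 and evaluating at 0.  The Fourier kernel
   wave s p = exp (- hbar s p) exchanges the two operations: it is symmetric, and
   the convolution acts on it (in the variable p) as multiplication by
   1 / (exp (- hbar s) - 1).  By induction on the word v,
   (v 1)(s) = (dual v (wave s))(0), where dual v is v reversed with a and b
   exchanged; at s = 0 this is the duality.  In this induction the contours of v
   and of dual v are unrelated, so that no contour ever has to be moved, except
   in the evaluation of the convolution of the kernel with an exponential.  There,
   the integral of exp (c z) / (exp (2 pi i z) - 1) over - e + i R is shown to be
   independent of e in ]0, 1[ by a second order estimate; its average over N
   equidistributed values of e is, by summation over roots of -1, the integral of
   - exp (i c x) / (1 + exp (- 2 pi N x)), and N tends to infinity. *)

Import Order.TTheory GRing.Theory Num.Theory.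
Import numFieldNormedType.Exports.
Import Normc.

Set Implicit Arguments.
Unset Strict Implicit.

Local Open Scope classical_set_scope.
Local Open Scope ring_scope.
Local Open Scope complex_scope.

(** * Complex-valued functions and their Lebesgue integrals *)

(** A word and its dual have in general different lengths, so [eps] assigns them different contours;
    this is why the duality is proved with two free contour parameters. Convergence dictates the
    rest. On a line with real part - e, the kernel decays as x -> -oo but only tends to -1 as x ->
    +oo. Its partner must therefore decay as x -> +oo, and may grow as x -> -oo at a rate below 2
    pi. A wave does this exactly when the real part of s lies in ]- 1 / omega, 0[. The constant 1
    does not: the final a of a word in [M0] supplies the decay. The initial b moves the argument off
    the pole of 1 / (exp (- hbar s) - 1) at 0. Dualizing exchanges these two conditions. The bound
    eps r < 1 / (r omega) keeps all partial sums t_1 + ... + t_j to the right of the next pole, - 1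
    / omega. The powers of hbar separate out: a block (hbar b)^alpha b a^(beta + 1) carries alpha +
    beta + 1 of them, which is symmetric in alpha and beta. *)

Section ComplexFacts.
Context {R : realType}.
Implicit Types (x y z : R[i]).

Lemma normc_ge0 z : 0 <= normc z.
Proof. by case: z => a b; exact: sqrtr_ge0. Qed.

Lemma normc_real (a : R) : normc a%:C = `|a|.
Proof. by rewrite /= expr0n addr0 sqrtr_sqr. Qed.

Lemma normc_i : normc ('i : R[i]) = 1.
Proof. by rewrite /= expr0n add0r expr1n sqrtr1. Qed.

Lemma normcB x y : normc (x - y) = normc (y - x).
Proof. by rewrite -(@normcN R (x - y)) opprB. Qed.

Lemma normc_triangle x y : normc x - normc y <= normc (x - y).
Proof. by rewrite lerBlDr; have := @le_normcD R (x - y) y; rewrite subrK. Qed.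

Lemma Re_le_normc z : `|complex.Re z| <= normc z.
Proof. by rewrite -lecR; exact: normc_ge_Re. Qed.

Lemma Im_le_normc z : `|complex.Im z| <= normc z.
Proof.
case: z => a b /=; rewrite -sqrtr_sqr ler_sqrt ?addr_ge0 ?sqr_ge0 //.
by rewrite lerDr sqr_ge0.
Qed.

Lemma normc_le_ReIm z : normc z <= `|complex.Re z| + `|complex.Im z|.
Proof.
case: z => a b; rewrite -[a +i* b]/(a +i* b).
have -> : a +i* b = a%:C + 'i * b%:C by rewrite [LHS]complexE.
apply: le_trans (le_normcD _ _) _.
by rewrite normcM normc_i mul1r !normc_real /= !(mul0r, mul1r, subr0, addr0, add0r).
Qed.

Lemma normc_eq0 z : (normc z == 0) = (z == 0).
Proof. by apply/eqP/eqP => [/eq0_normc //|->]; rewrite normc0. Qed.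

Lemma cReM x y : complex.Re (x * y) =
  complex.Re x * complex.Re y - complex.Im x * complex.Im y.
Proof. by case: x y => [a b] [c d]. Qed.

Lemma cImM x y : complex.Im (x * y) =
  complex.Re x * complex.Im y + complex.Im x * complex.Re y.
Proof. by case: x y => [a b] [c d]. Qed.

Lemma cReD x y : complex.Re (x + y) = complex.Re x + complex.Re y.
Proof. by case: x y => [a b] [c d]. Qed.

Lemma cImD x y : complex.Im (x + y) = complex.Im x + complex.Im y.
Proof. by case: x y => [a b] [c d]. Qed.

Lemma cReN x : complex.Re (- x) = - complex.Re x.
Proof. by case: x. Qed.

Lemma cImN x : complex.Im (- x) = - complex.Im x.
Proof. by case: x. Qed.

Lemma complex_ext x y : complex.Re x = complex.Re y ->
  complex.Im x = complex.Im y -> x = y.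
Proof. by case: x y => [a b] [c d] /= -> ->. Qed.

Lemma cexpD x y : cexp (x + y) = cexp x * cexp y.
Proof.
case: x y => [a b] [c d]; rewrite /cexp /=; apply: complex_ext => /=.
  by rewrite expRD cosD; ring.
by rewrite expRD sinD; ring.
Qed.

Lemma cexp0 : cexp (0 : R[i]) = 1.
Proof. by rewrite /cexp /= expR0 cos0 sin0 mulr1 mulr0. Qed.

Lemma normc_cexp z : normc (cexp z) = expR (complex.Re z).
Proof.
rewrite /cexp /= !exprMn -mulrDr cos2Dsin2 mulr1 sqrtr_sqr.
by rewrite ger0_norm // expR_ge0.
Qed.

Lemma cexpX z n : cexp z ^+ n = cexp (z *+ n).
Proof.
by elim: n => [|n ih]; rewrite ?cexp0 ?expr0 // exprS ih -cexpD mulrS.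
Qed.

End ComplexFacts.

(** * Measurability of complex-valued functions *)

Section ComplexMeasurable.
Context {R : realType} {d : measure_display} {T : measurableType d}.
Implicit Types f g : T -> R[i].

Definition cmeasurable f :=
  measurable_fun setT (fun x => complex.Re (f x)) /\
  measurable_fun setT (fun x => complex.Im (f x)).

Lemma cmeasurable_cst (c : R[i]) : cmeasurable (fun=> c).
Proof. by split; exact: measurable_cst. Qed.

Lemma cmeasurableD f g : cmeasurable f -> cmeasurable g ->
  cmeasurable (fun x => f x + g x).
Proof.
move=> [f1 f2] [g1 g2]; split.
  by under eq_fun do rewrite cReD; exact: measurable_funD.
by under eq_fun do rewrite cImD; exact: measurable_funD.
Qed.

Lemma cmeasurableM f g : cmeasurable f -> cmeasurable g ->
  cmeasurable (fun x => f x * g x).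
Proof.
move=> [f1 f2] [g1 g2]; split.
  under eq_fun do rewrite cReM; apply: measurable_funB; exact: measurable_funM.
by under eq_fun do rewrite cImM; apply: measurable_funD; exact: measurable_funM.
Qed.

Lemma cmeasurableN f : cmeasurable f -> cmeasurable (fun x => - f x).
Proof.
move=> [f1 f2]; split.
  by under eq_fun do rewrite cReN; exact: measurable_funN.
by under eq_fun do rewrite cImN; exact: measurable_funN.
Qed.

Lemma cmeasurableB f g : cmeasurable f -> cmeasurable g ->
  cmeasurable (fun x => f x - g x).
Proof. by move=> mf mg; apply: cmeasurableD => //; exact: cmeasurableN. Qed.

Lemma cmeasurable_real (u : T -> R) : measurable_fun setT u ->
  cmeasurable (fun x => (u x)%:C).
Proof. by move=> mu; split => //=; exact: measurable_cst. Qed.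

Lemma cmeasurable_complex (u v : T -> R) : measurable_fun setT u ->
  measurable_fun setT v -> cmeasurable (fun x => u x +i* v x).
Proof. by move=> mu mv; split. Qed.

Lemma cmeasurable_cexp f : cmeasurable f -> cmeasurable (fun x => cexp (f x)).
Proof.
move=> [f1 f2]; split => /=; apply: measurable_funM.
- by apply: measurableT_comp => //; exact: measurable_expR.
- apply: measurableT_comp f2; apply: continuous_measurable_fun.
  exact: continuous_cos.
- by apply: measurableT_comp => //; exact: measurable_expR.
- apply: measurableT_comp f2; apply: continuous_measurable_fun.
  exact: continuous_sin.
Qed.

Lemma cmeasurableV f : cmeasurable f -> cmeasurable (fun x => (f x)^-1).
Proof.
move=> [f1 f2].
pose n2 x := complex.Re (f x) ^+ 2 + complex.Im (f x) ^+ 2.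
have mn : measurable_fun setT (fun x => (n2 x)^-1).
  (* The convention 0^-1 = 0 agrees with [powR 0 (-1)], so the zeros of [f] are covered too. *)
  have -> : (fun x => (n2 x)^-1) = (fun y => powR y (-1)) \o n2.
    apply/funext => x /=; rewrite powR_inv1 // addr_ge0 ?sqr_ge0 //.
  apply: measurableT_comp; first exact: measurable_powR.
  by apply: measurable_funD; exact: measurable_funX.
have e x : (f x)^-1 = (complex.Re (f x) * (n2 x)^-1) +i*
                      - (complex.Im (f x) * (n2 x)^-1).
  by rewrite /n2; case: (f x) => a b; apply: complex_ext; rewrite /= ?mulNr.
split; under eq_fun do rewrite e /=; last apply: measurable_funN;
  exact: measurable_funM.
Qed.

End ComplexMeasurable.

Lemma cmeasurable_comp {R : realType} d1 d2 (T1 : measurableType d1)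
    (T2 : measurableType d2) (g : T1 -> T2) (f : T2 -> R[i]) :
  cmeasurable f -> measurable_fun setT g -> cmeasurable (fun x => f (g x)).
Proof.
move=> [f1 f2] mg; split.
  by rewrite -[X in measurable_fun _ X]/((fun x => complex.Re (f x)) \o g);
    exact: measurableT_comp.
by rewrite -[X in measurable_fun _ X]/((fun x => complex.Im (f x)) \o g);
  exact: measurableT_comp.
Qed.

(** * Integration of complex-valued functions on the real line *)

Section ComplexIntegral.
Context {R : realType}.
Implicit Types (f g : R -> R[i]) (u v : R -> R).
Local Notation mu := (@lebesgue_measure R).

Definition rintegrable u := mu.-integrable setT (EFin \o u).

Lemma rintegrable_le u v : measurable_fun setT u ->
  (forall x, `|u x| <= v x) -> rintegrable v -> rintegrable u.
Proof.
move=> mu_ uv iv; apply: le_integrable iv => //; first exact/measurable_EFinP.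
by move=> x _ /=; rewrite lee_fin; apply: le_trans (uv x) (ler_norm _).
Qed.

Definition cintegrable f :=
  rintegrable (fun x => complex.Re (f x)) /\
  rintegrable (fun x => complex.Im (f x)).

Lemma cintegrable_le f v : cmeasurable f ->
  (forall x, normc (f x) <= v x) -> rintegrable v -> cintegrable f.
Proof.
move=> [f1 f2] fv iv; split; apply: rintegrable_le (iv) => // x.
  by apply: le_trans (fv x); exact: Re_le_normc.
by apply: le_trans (fv x); exact: Im_le_normc.
Qed.

Lemma rintegrableD u v : rintegrable u -> rintegrable v ->
  rintegrable (fun x => u x + v x).
Proof. by move=> iu iv; exact: (integrableD _ iu iv). Qed.

Lemma rintegrableZ (k : R) u : rintegrable u -> rintegrable (fun x => k * u x).
Proof. by move=> iu; exact: (integrableZl _ k iu). Qed.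

Lemma cintegrableD f g : cintegrable f -> cintegrable g ->
  cintegrable (fun x => f x + g x).
Proof.
move=> [f1 f2] [g1 g2]; split.
  by under eq_fun do rewrite cReD; exact: rintegrableD.
by under eq_fun do rewrite cImD; exact: rintegrableD.
Qed.

Lemma cintegralD f g : cintegrable f -> cintegrable g ->
  cintegral (fun x => f x + g x) = cintegral f + cintegral g.
Proof.
move=> [f1 f2] [g1 g2]; rewrite /cintegral; apply: complex_ext => /=.
  rewrite -RintegralD //; apply: eq_Rintegral => x _; exact: cReD.
rewrite -RintegralD //; apply: eq_Rintegral => x _; exact: cImD.
Qed.

Lemma cintegrableZ c f : cintegrable f -> cintegrable (fun x => c * f x).
Proof.
move=> [f1 f2]; split.
  under eq_fun do rewrite cReM -mulNr.
  by apply: rintegrableD; exact: rintegrableZ.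
by under eq_fun do rewrite cImM; apply: rintegrableD; exact: rintegrableZ.
Qed.

Lemma cintegralZ c f : cintegrable f ->
  cintegral (fun x => c * f x) = c * cintegral f.
Proof.
move=> [f1 f2]; apply: complex_ext; rewrite ?cReM ?cImM /=.
  rewrite -!RintegralZl // -RintegralB //; try exact: rintegrableZ.
  by apply: eq_Rintegral => x _; exact: cReM.
rewrite -!RintegralZl // -RintegralD //; try exact: rintegrableZ.
by apply: eq_Rintegral => x _; exact: cImM.
Qed.

Lemma cintegrableB f g : cintegrable f -> cintegrable g ->
  cintegrable (fun x => f x - g x).
Proof.
move=> fi gi; under eq_fun do rewrite -[X in _ + X]mulN1r.
by apply: cintegrableD => //; exact: cintegrableZ.
Qed.

Lemma cintegralB f g : cintegrable f -> cintegrable g ->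
  cintegral (fun x => f x - g x) = cintegral f - cintegral g.
Proof.
move=> fi gi; under [in LHS]eq_fun do rewrite -[X in _ + X]mulN1r.
by rewrite cintegralD ?cintegralZ ?mulN1r //; exact: cintegrableZ.
Qed.

Lemma cintegral_sum (I : Type) (r : seq I) (F : I -> R -> R[i]) :
  (forall i, cintegrable (F i)) ->
  cintegrable (fun x => \sum_(i <- r) F i x) /\
  cintegral (fun x => \sum_(i <- r) F i x) = \sum_(i <- r) cintegral (F i).
Proof.
move=> iF; elim: r => [|i r [ih1 ih2]].
  under eq_fun do rewrite big_nil; rewrite big_nil.
  split; first by split; exact: integrable0.
  rewrite /cintegral /= !Rintegral_cst // !mul0r; exact: complex_ext.
under eq_fun do rewrite big_cons; rewrite big_cons.
by split; [exact: cintegrableD | rewrite cintegralD // ih2].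
Qed.

Lemma eq_cintegral f g : f =1 g -> cintegral f = cintegral g.
Proof. by move=> /funext ->. Qed.

(** The factor 2 comes from bounding the real and imaginary parts separately; later estimates only
    matter up to a constant. *)
Lemma cintegral_le f v : cmeasurable f -> rintegrable v ->
  (forall x, normc (f x) <= v x) ->
  normc (cintegral f) <= 2 * (\int[mu]_x v x)%R.
Proof.
move=> mf iv fv; have [f1 f2] := cintegrable_le mf fv iv.
apply: le_trans (normc_le_ReIm _) _; rewrite mulrDl mul1r /=; apply: lerD.
  apply: le_trans (le_normr_Rintegral _ f1) _ => //.
  apply: le_Rintegral => //; first exact: integrable_norm.
  by move=> x _; apply: le_trans (fv x); exact: Re_le_normc.
apply: le_trans (le_normr_Rintegral _ f2) _ => //.
apply: le_Rintegral => //; first exact: integrable_norm.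
by move=> x _; apply: le_trans (fv x); exact: Im_le_normc.
Qed.

(** By Tonelli: the inner integral of |h| is at most |u x| times the integral of |v|. *)
Lemma rintegrable_prod u v (h : R * R -> R) : measurable_fun setT h ->
  rintegrable u -> rintegrable v -> (forall x y, `|h (x, y)| <= u x * v y) ->
  ((mu \x mu)%E).-integrable setT (EFin \o h).
Proof.
move=> mh iu iv huv.
have mh' : measurable_fun setT (EFin \o h) by exact/measurable_EFinP.
apply/integrable12ltyP => //.
have [v0 v0E] : exists w, w = (\int[mu]_y `|(v y)%:E|)%E by eexists.
have w0 : (0 <= v0)%E by rewrite v0E; exact: integral_ge0.
have wy : (v0 < +oo)%E by rewrite v0E; case/integrableP : iv.
have vm : measurable_fun setT (fun y => `|(v y)%:E|)%E.
  by apply: measurableT_comp => //; case/integrableP : iv.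
have um : measurable_fun setT (fun y => `|(u y)%:E|)%E.
  by apply: measurableT_comp => //; case/integrableP : iu.
apply: (@le_lt_trans _ _ (\int[mu]_x (`|(u x)%:E| * v0))%E).
  apply: ge0_le_integral => //.
  - by move=> x _; exact: integral_ge0.
  - apply: (@measurable_fun_fubini_tonelli_F _ _ _ _ R mu (fun z => `|(h z)%:E|)%E) => //.
    exact: measurableT_comp.
  - by apply: emeasurable_funM => //; exact: measurable_cst.
  move=> x _; rewrite v0E -ge0_integralZl //.
  apply: ge0_le_integral => //.
  - by apply: measurableT_comp => //; apply: measurableT_comp mh' _;
      exact: measurable_pair1.
  - by apply: emeasurable_funM => //; exact: measurable_cst.
  - move=> y _; rewrite /= lee_fin; apply: le_trans (huv x y) _.
    by rewrite -normrM; exact: ler_norm.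
rewrite ge0_integralZr //; apply: lte_mul_pinfty => //.
  exact: integral_ge0.
  rewrite ge0_fin_numE; last exact: integral_ge0.
  by case/integrableP : iu.
Qed.

Lemma cintegral_fubini (h : R * R -> R[i]) u v : cmeasurable h ->
  rintegrable u -> rintegrable v -> (forall x y, normc (h (x, y)) <= u x * v y) ->
  cintegral (fun x => cintegral (fun y => h (x, y))) =
  cintegral (fun y => cintegral (fun x => h (x, y))).
Proof.
move=> [h1 h2] iu iv huv.
have key (k : R * R -> R) : measurable_fun setT k ->
    (forall x y, `|k (x, y)| <= u x * v y) ->
    (\int[mu]_x (\int[mu]_y k (x, y)))%R = (\int[mu]_y (\int[mu]_x k (x, y)))%R.
  move=> mk kuv; rewrite /Rintegral; congr fine.
  have mk' : measurable_fun setT (EFin \o k) by exact/measurable_EFinP.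
  transitivity (\int[mu]_x \int[mu]_y (k (x, y))%:E)%E.
    apply: eq_integral => x _; rewrite fineK //; apply: integrable_fin_num => //.
    apply: (@rintegrable_le _ (fun y => u x * v y)) (rintegrableZ _ iv).
      by apply: measurableT_comp mk _; exact: measurable_pair1.
    by move=> y; exact: kuv.
  transitivity (\int[mu]_y \int[mu]_x (k (x, y))%:E)%E.
    by have := Fubini (rintegrable_prod mk iu iv kuv).
  apply: eq_integral => y _; rewrite fineK //; apply: integrable_fin_num => //.
  apply: (@rintegrable_le _ (fun x => v y * u x)) (rintegrableZ _ iu).
    by apply: measurableT_comp mk _; exact: measurable_pair2.
  by move=> x; rewrite mulrC; exact: kuv.
apply: complex_ext => /=.
  apply: (key (fun z => complex.Re (h z))) => // x y.
  by apply: le_trans (huv x y); exact: Re_le_normc.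
apply: (key (fun z => complex.Im (h z))) => // x y.
by apply: le_trans (huv x y); exact: Im_le_normc.
Qed.

(** The positive and negative parts have integrals measurable in the parameter by Tonelli; [fine] is
    measurable and takes care of infinite values. *)
Lemma measurable_Rintegral d (T : measurableType d) (h : T * R -> R) :
  measurable_fun setT h ->
  measurable_fun setT (fun x => \int[mu]_y h (x, y))%R.
Proof.
move=> mh; have mh' : measurable_fun setT (EFin \o h) by exact/measurable_EFinP.
rewrite /Rintegral; apply: measurableT_comp; first exact: fine_measurable.
have -> : (fun x => \int[mu]_y (h (x, y))%:E)%E =
    (fubini_F mu (funepos (EFin \o h)) \- fubini_F mu (funeneg (EFin \o h)))%E.
  by apply/funext => x; rewrite integralE /fubini_F; congr (_ - _)%E;
    apply: eq_integral => y _; rewrite ?funeposE ?funenegE.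
apply: emeasurable_funB; apply: measurable_fun_fubini_tonelli_F => //.
  exact: measurable_funepos.
exact: measurable_funeneg.
Qed.

Lemma cmeasurable_cintegral d (T : measurableType d) (h : T * R -> R[i]) :
  cmeasurable h -> cmeasurable (fun x => cintegral (fun y => h (x, y))).
Proof.
move=> [h1 h2]; split => /=.
  exact: (measurable_Rintegral h1).
exact: (measurable_Rintegral h2).
Qed.

(** The image of Lebesgue measure under a translation agrees with it on half-open intervals, hence
    everywhere by uniqueness. *)
Lemma integral_translation (f : R -> \bar R) (c : R) : measurable_fun setT f ->
  mu.-integrable setT (fun x => f (x + c)%R) ->
  (\int[mu]_x f (x + c)%R = \int[mu]_x f x)%E.
Proof.
move=> mf intf.
pose phi : measurableTypeR R -> measurableTypeR R := fun x => x + c.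
have mphi : measurable_fun setT phi by exact: measurable_funD.
have muE (A : set (measurableTypeR R)) : measurable A -> pushforward mu phi A = mu A.
  move=> mA; apply/esym/lebesgue_measure_unique => //= _ [[a b]] _ <-.
  rewrite /pushforward /=.
  have -> : phi @^-1` `]a, b] = `]a - c, b - c]%classic.
    by apply/seteqP; split => x /=; rewrite /phi !in_itv /= lerBrDr ltrBlDr.
  rewrite !lebesgue_measure_itv /= !lte_fin ltrD2r.
  by case: ifP => // _; rewrite -!EFinD; congr EFin; ring.
have intf' : mu.-integrable (phi @^-1` setT) (f \o phi) by rewrite preimage_setT.
have := integral_pushforward mphi mf intf' measurableT.
rewrite preimage_setT => <-.
by apply: eq_measure_integral => A mA _; exact: muE.
Qed.

Lemma cintegral_translation f (c : R) : cmeasurable f ->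
  cintegrable (fun x => f (x + c)) ->
  cintegral (fun x => f (x + c)) = cintegral f.
Proof.
move=> [f1 f2] [i1 i2]; apply: complex_ext; rewrite /= /Rintegral; congr fine.
  apply: (@integral_translation (fun x => (complex.Re (f x))%:E)) => //.
  exact/measurable_EFinP.
apply: (@integral_translation (fun x => (complex.Im (f x))%:E)) => //.
exact/measurable_EFinP.
Qed.

(** Common majorant of the line integrals: the kernel decays exponentially at one end of the line,
    the function paired with it at the other. *)
Definition gexp (l x : R) := expR (- l * `|x|).

Lemma measurable_gexp l : measurable_fun setT (gexp l).
Proof.
apply: measurableT_comp; first exact: measurable_expR.
by apply: measurable_funM => //; exact: normr_measurable.
Qed.

(** The exponential density divided by l and its reflection cover the two half-lines and have
    integral 1 / l each; both count at 0, so [gexp] is only bounded by their sum. *)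
Lemma rintegrable_gexp l : 0 < l ->
  rintegrable (gexp l) /\ (\int[mu]_x gexp l x)%R <= 2 / l.
Proof.
move=> l0; pose h x := l^-1 * exponential_pdf l x.
have ih : rintegrable h by apply: rintegrableZ; exact: integrable_exponential_pdf.
have Ih : (\int[mu]_x h x)%R = l^-1.
  rewrite RintegralZl //; last exact: integrable_exponential_pdf.
  by rewrite /Rintegral integral_exponential_pdf //= mulr1.
have h0 x : 0 <= h x.
  by rewrite mulr_ge0 ?invr_ge0 ?exponential_pdf_ge0 // ltW.
have mh : measurable_fun setT h.
  by apply: measurable_funM => //; exact: measurable_exponential_pdf.
have mhN : measurable_fun setT (fun x : R => h (- x)).
  by apply: measurableT_comp => //; exact: oppr_measurable.
have phi0 : measurable_fun setT (-%R : measurableTypeR R -> measurableTypeR R).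
  exact: oppr_measurable.
have ENN : (\int[mu]_x (h (- x))%:E = \int[mu]_x (h x)%:E)%E.
  have := @ge0_integral_pushforward _ _ _ _ R _ phi0 mu setT (EFin \o h) measurableT.
  rewrite preimage_setT => <-.
  - by apply: eq_measure_integral => A mA _; exact: lebesgue_measureN.
  - exact/measurable_EFinP.
  - by move=> x _; rewrite lee_fin.
have ihN : rintegrable (fun x => h (- x)).
  apply/integrableP; split; first exact/measurable_EFinP.
  under eq_integral do rewrite /= ger0_norm //.
  rewrite ENN; case/integrableP : ih => _.
  by under eq_integral do rewrite /= ger0_norm //.
have gh x : gexp l x <= h x + h (- x).
  have key y : 0 <= y -> gexp l y = h y.
    move=> y0; rewrite /h exponential_pdfE // mulrA mulVf ?gt_eqF // mul1r.
    by rewrite /gexp ger0_norm.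
  have [x0|x0] := leP 0 x; first by rewrite key // lerDl.
  by rewrite /gexp -normrN -/(gexp l (- x)) key ?lerDr // oppr_ge0 ltW.
have ig : rintegrable (gexp l).
  apply: rintegrable_le (rintegrableD ih ihN); first exact: measurable_gexp.
  by move=> x; rewrite ger0_norm ?expR_ge0.
split => //.
apply: (@le_trans _ _ (\int[mu]_x (h x + h (- x)))%R).
  by apply: le_Rintegral => //; exact: rintegrableD.
rewrite RintegralD // Ih [X in _ + X](_ : _ = l^-1); last first.
  by rewrite /Rintegral ENN.
by rewrite -mulr2n -[X in X *+ 2]mul1r -mulrnAl.
Qed.

End ComplexIntegral.

(** * Estimates for the exponential and for the kernel *)

Section ExpEstimates.
Context {R : realType}.

Lemma expR_second_order (y : R) : `|expR y - 1 - y| <= y ^+ 2 * expR `|y|.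
Proof.
have h1 := expR_ge1Dx y; have h2 := expR_ge1Dx (- y).
have e0 : expR y * expR (- y) = 1 by rewrite expRxMexpNx_1.
have p := expR_gt0 y; have p' := expR_gt0 (- y).
rewrite ger0_norm; last by lra.
(* This is 1 - y <= exp (- y) multiplied by exp y. It bounds the remainder by y (exp y - 1), and
   bounding exp y - 1 once more gives the square. *)
have h3 : expR y - 1 <= y * expR y by nra.
have [y0|y0] := leP 0 y; first by rewrite ger0_norm //; nra.
have := expR_ge1Dx `|y|; have := normr_ge0 y; rewrite ltr0_norm //; nra.
Qed.

Lemma sin_le_id (y : R) : 0 <= y -> sin y <= y.
Proof.
rewrite le_eqVlt => /predU1P[<-|y0]; first by rewrite sin0.
have [|t _] := @MVT R sin cos 0 y y0 (fun x _ => is_derive_sin x).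
  by apply: continuous_subspaceT; exact: continuous_sin.
rewrite sin0 !subr0 => ->; have := cos_le1 t; nra.
Qed.

Lemma normr_sin_le (y : R) : `|sin y| <= `|y|.
Proof.
have key (z : R) : 0 <= z -> `|sin z| <= z.
  move=> z0; have hz := sin_le_id z0; rewrite ler_norml hz andbT.
  have [zpi|zpi] := leP z pi; last first.
    by have := sin_geN1 z; have := @pi_ge2 R; lra.
  by have := @sin_ge0_pi R z; rewrite z0 zpi => /(_ isT); lra.
have [y0|y0] := leP 0 y; first by rewrite (ger0_norm y0); exact: key.
by rewrite -normrN -sinN (ltr0_norm y0); apply: key; rewrite oppr_ge0 ltW.
Qed.

Lemma cos_second_order (y : R) : `|cos y - 1| <= y ^+ 2.
Proof.
have -> : cos y - 1 = - 2 * sin (y / 2) ^+ 2.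
  have -> : cos y = cos ((y / 2) *+ 2) by congr cos; rewrite -mulr_natr; field.
  by rewrite cos_mulr2n; have := cos2Dsin2 (y / 2); rewrite -mulr_natr; lra.
have p : 0 <= 2 * sin (y / 2) ^+ 2 by apply: mulr_ge0 => //; exact: sqr_ge0.
rewrite mulNr normrN (ger0_norm p).
have h : sin (y / 2) ^+ 2 <= (y / 2) ^+ 2.
  rewrite -[X in X <= _]real_normK ?num_real // -[leRHS]real_normK ?num_real //.
  by rewrite lerXn2r ?nnegrE ?normr_ge0 // normr_sin_le.
have e : y ^+ 2 = 4 * (y / 2) ^+ 2 by field.
by have := sqr_ge0 (y / 2); rewrite e; lra.
Qed.

Lemma sin_second_order (y : R) : `|sin y - y| <= 2 * y ^+ 2.
Proof.
have key (z : R) : 0 <= z -> `|sin z - z| <= 2 * z ^+ 2.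
  rewrite le_eqVlt => /predU1P[<-|z0].
    by rewrite sin0 subrr normr0 expr0n mulr0.
  have [|t /[!in_itv]/= /andP[t0 tz]] :=
      @MVT R sin cos 0 z z0 (fun x _ => is_derive_sin x).
    by apply: continuous_subspaceT; exact: continuous_sin.
  rewrite sin0 !subr0 => ->.
  have -> : cos t * z - z = (cos t - 1) * z by ring.
  rewrite normrM (gtr0_norm z0) expr2 mulrA ler_pM2r //.
  have h1 := cos_second_order t.
  (* [h1] settles z <= 1, this bound z > 1: the cubic remainder is traded for a quadratic one valid
     on the whole half-line. *)
  have h2 : `|cos t - 1| <= 2.
    by rewrite ler_norml; have := cos_le1 t; have := cos_geN1 t; lra.
  by have [z1|z1] := leP z 1; nra.
have [y0|y0] := leP 0 y; first exact: key.
have -> : sin y - y = - (sin (- y) - - y) by rewrite sinN; ring.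
by rewrite normrN -sqrrN; apply: key; rewrite oppr_ge0 ltW.
Qed.

Lemma cexp_second_order (w : R[i]) : exists2 C : R, 0 <= C &
  forall h : R, 0 <= h <= 1 ->
    normc (cexp (w * h%:C) - 1 - w * h%:C) <= C * h ^+ 2.
Proof.
case: w => a b.
pose M := expR `|a|.
have M0 : 0 <= M by exact: expR_ge0.
(* [C1] serves the real part and [C2] the imaginary part; [M] bounds every real exponential because
   0 <= h <= 1. *)
pose C1 := M * (a ^+ 2 + b ^+ 2).
pose C2 := 2 * (M * b ^+ 2) + (a ^+ 2 * M + `|a|) * `|b|.
have C10 : 0 <= C1 by rewrite mulr_ge0 // addr_ge0 ?sqr_ge0.
have C20 : 0 <= C2.
  apply: addr_ge0; first by rewrite mulr_ge0 // mulr_ge0 // sqr_ge0.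
  by rewrite mulr_ge0 // addr_ge0 // mulr_ge0 // sqr_ge0.
exists (C1 + C2); first by rewrite addr_ge0.
move=> h /andP[h0 h1].
have EM : expR (a * h) <= M.
  rewrite ler_expR; apply: le_trans (ler_norm _) _.
  by rewrite normrM (ger0_norm h0) ler_piMr.
have EM' : expR `|a * h| <= M.
  by rewrite ler_expR normrM (ger0_norm h0) ler_piMr.
have E0 := expR_ge0 (a * h).
have es := expR_second_order (a * h).
have es' : `|expR (a * h) - 1 - a * h| <= M * (a ^+ 2 * h ^+ 2).
  apply: le_trans es _; rewrite exprMn mulrC ler_wpM2r //.
  by rewrite mulr_ge0 ?sqr_ge0.
have cs := cos_second_order (b * h).
have ss := sin_second_order (b * h).
apply: le_trans (normc_le_ReIm _) _; rewrite mulrDl.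
apply: lerD; rewrite /= !(mulr0, mul0r, addr0, subr0, add0r, oppr0).
  have -> : expR (a * h) * cos (b * h) - 1 - a * h =
    expR (a * h) * (cos (b * h) - 1) + (expR (a * h) - 1 - a * h) by ring.
  apply: le_trans (ler_normD _ _) _; rewrite normrM (ger0_norm E0).
  have -> : C1 * h ^+ 2 = M * (b * h) ^+ 2 + M * (a ^+ 2 * h ^+ 2).
    by rewrite /C1; ring.
  by apply: lerD => //; exact: ler_pM.
have -> : expR (a * h) * sin (b * h) - b * h =
  expR (a * h) * (sin (b * h) - b * h) + (expR (a * h) - 1) * (b * h) by ring.
apply: le_trans (ler_normD _ _) _; rewrite normrM (ger0_norm E0).
(* The last summand is the slack h^3 <= h^2 left by the bound on exp (a h) - 1. *)
have -> : C2 * h ^+ 2 = M * (2 * (b * h) ^+ 2) +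
    (a ^+ 2 * h * M + `|a|) * h * (`|b| * h) + a ^+ 2 * M * `|b| * (h * h * (1 - h)).
  by rewrite /C2; ring.
have rest : 0 <= a ^+ 2 * M * `|b| * (h * h * (1 - h)).
  apply: mulr_ge0; first by rewrite mulr_ge0 // mulr_ge0 // sqr_ge0.
  by rewrite mulr_ge0 ?subr_ge0 // mulr_ge0.
rewrite -[leLHS]addr0; apply: lerD; last exact: rest.
apply: lerD; first exact: ler_pM.
rewrite !normrM (ger0_norm h0) ler_wpM2r ?mulr_ge0 ?normr_ge0 //.
have -> : expR (a * h) - 1 = (expR (a * h) - 1 - a * h) + a * h by ring.
apply: le_trans (ler_normD _ _) _.
rewrite mulrDl; apply: lerD; last by rewrite normrM (ger0_norm h0).
by apply: le_trans es' _; rewrite le_eqVlt; apply/orP; left; apply/eqP; ring.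
Qed.

Lemma cexp_first_order (w : R[i]) : exists2 C : R, 0 <= C &
  forall h : R, 0 <= h <= 1 -> normc (cexp (w * h%:C) - 1) <= C * h.
Proof.
have [C C0 HC] := cexp_second_order w.
exists (C + normc w); first by rewrite addr_ge0 ?normc_ge0.
move=> h h01; have := HC h h01; set z := cexp _ - 1.
have -> : z = (z - w * h%:C) + w * h%:C by ring.
move=> zh; apply: le_trans (le_normcD _ _) _.
move: zh; rewrite addrK normcM normc_real => zh.
case/andP: h01 => h0 h1; rewrite (ger0_norm h0).
by have : 0 <= C * (h * (1 - h)); [rewrite !mulr_ge0 // subr_ge0 | lra].
Qed.

(** Used for each passage to the limit below: errors are kept explicit, of order 1 / n. *)
Lemma arch_le0 (x C : R) : 0 <= C -> (forall n : nat, (0 < n)%N -> x <= C / n%:R) ->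
  x <= 0.
Proof.
move=> C0 H; rewrite leNgt; apply/negP => x0.
pose n := (Num.truncn (C / x)).+1.
have := H n isT; rewrite ler_pdivlMr ?ltr0n //; apply/negP; rewrite -ltNge.
by rewrite mulrC -ltr_pdivrMr // /n truncnS_gt.
Qed.

(** Cut into n equal steps, the total increment is at most n C ((e2 - e1) / n)^2, which is of order
    1 / n. Thus no derivative of [f] has to be formed, which for an integral depending on e would
    require differentiation under the integral sign. *)
Lemma const_of_quadratic_increments (f : R -> R[i]) (C e1 e2 : R) :
  0 <= C -> e1 <= e2 -> e2 - e1 <= 1 ->
  (forall e h, e1 <= e -> 0 <= h <= 1 -> e + h <= e2 ->
     normc (f (e + h) - f e) <= C * h ^+ 2) -> f e1 = f e2.
Proof.
move=> C0 e12 e21 H; apply/eqP; rewrite eq_sym -subr_eq0 -normc_eq0.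
rewrite eq_le normc_ge0 andbT.
apply: (@arch_le0 _ (C * (e2 - e1) ^+ 2)); first by rewrite mulr_ge0 ?sqr_ge0.
move=> n n0; have n0' : 0 < n%:R :> R by rewrite ltr0n.
pose d := (e2 - e1) / n%:R.
have d0 : 0 <= d by rewrite divr_ge0 ?subr_ge0 // ltW.
have nd : n%:R * d = e2 - e1 by rewrite /d mulrC divfK // gt_eqF.
have n1 : 1 <= n%:R :> R by rewrite ler1n.
have d1 : d <= 1 by nra.
have key k : (k <= n)%N -> normc (f (e1 + k%:R * d) - f e1) <= k%:R * (C * d ^+ 2).
  elim: k => [_|k ih kn]; first by rewrite !mul0r addr0 subrr normc0.
  have -> : f (e1 + k.+1%:R * d) - f e1 = (f (e1 + k%:R * d + d) - f (e1 + k%:R * d))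
      + (f (e1 + k%:R * d) - f e1).
    by rewrite addrA subrK -natr1 mulrDl mul1r addrA.
  apply: le_trans (le_normcD _ _) _.
  have kn' : k.+1%:R <= n%:R :> R by rewrite ler_nat.
  have k0 : 0 <= k%:R :> R by [].
  move: kn'; rewrite -natr1 => kn'.
  rewrite mulrDl mul1r addrC lerD ?ih 1?ltnW //.
  apply: H; [by nra | by rewrite d0 | by nra].
have := key n (leqnn n); have -> : e1 + n%:R * d = e2 by rewrite nd; ring.
move=> /le_trans; apply.
by rewrite /d expr_div_n le_eqVlt; apply/orP; left; apply/eqP; field; rewrite gt_eqF.
Qed.

End ExpEstimates.

(** * Bounds for the kernel on vertical lines *)

Section KernelBounds.
Context {R : realType}.
Local Notation mu := (@lebesgue_measure R).

Definition kern (t : R[i]) : R[i] := (cexp (two_pi_i * t) - 1)^-1.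

Lemma two_pi_iE (x y : R) :
  two_pi_i * (x +i* y) = (- (2 * pi * y)) +i* (2 * pi * x) :> R[i].
Proof. by apply: complex_ext => /=; ring. Qed.

Lemma normc_cexp_sub1 (e : R) :
  normc (cexp (two_pi_i * e%:C) - 1 : R[i]) = 2 * `|sin (pi * e)|.
Proof.
rewrite two_pi_iE mulr0 oppr0 /cexp /= expR0 !mul1r subr0.
have -> : 2 * pi * e = (pi * e) *+ 2 by rewrite -[RHS]mulr_natl; ring.
rewrite cos_mulr2n sin_mulr2n cos2sin2.
have := cos2Dsin2 (pi * e); set s := sin _; set k := cos _ => ks.
have -> : (1 - s ^+ 2) *+ 2 - 1 - 1 = - (2 * s ^+ 2) by rewrite -mulr_natl; ring.
rewrite sqrrN -[_ *+ 2]mulr_natl.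
rewrite [X in Num.sqrt X](_ : _ = (2 * s) ^+ 2 * (k ^+ 2 + s ^+ 2)); last by ring.
by rewrite ks mulr1 sqrtr_sqr normrM normr_nat mulr1.
Qed.

(** The denominator is r u - 1 with r > 0 and |u| = 1. Both |r - 1| and |u - 1| / 2 = |sin (pi e)|
    are at most |r u - 1|; with 1 + r <= 2 + |r - 1| and |sin| <= 1 this gives the constant 3. *)
Lemma kern_denominator_bound (e x : R) :
  `|sin (pi * e)| / 3 * (1 + expR (- (2 * pi * x))) <=
  normc (cexp (two_pi_i * (e +i* x)) - 1).
Proof.
set u := cexp (two_pi_i * e%:C) : R[i]; set r := expR _.
have -> : cexp (two_pi_i * (e +i* x)) = r%:C * u.
  have -> : e +i* x = 'i * x%:C + e%:C by apply: complex_ext => /=; ring.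
  rewrite mulrDr cexpD; congr (_ * _).
  by apply: complex_ext; rewrite /= ?(mul0r, mul1r, mulr0, add0r, addr0,
    sub0r, cos0, sin0, oppr0, subr0, mulr1).
have r0 : 0 <= r by exact: expR_ge0.
have nu : normc u = 1.
  by rewrite /u normc_cexp two_pi_iE /= mulr0 oppr0 expR0.
have nru : normc (r%:C * u) = r by rewrite normcM nu mulr1 normc_real ger0_norm.
have h1 : `|r - 1| <= normc (r%:C * u - 1).
  rewrite ler_norml; have := normc_triangle (r%:C * u) 1.
  have := normc_triangle 1 (r%:C * u); rewrite nru normc1 normcB; lra.
have h2 : normc (u - 1) <= normc (u - r%:C * u) + normc (r%:C * u - 1).
  by have := @le_normcD R (u - r%:C * u) (r%:C * u - 1); rewrite addrA subrK.
have h3 : normc (u - r%:C * u) = `|r - 1|.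
  rewrite normcB -[X in _ - X]mul1r -mulrBl normcM nu mulr1.
  by rewrite -normc_real rmorphB.
have h4 := normc_cexp_sub1 e; rewrite -/u in h4.
have h5 : `|sin (pi * e)| <= 1 by exact: sin_max.
have h6 := normr_ge0 (sin (pi * e)).
have h7 : r <= 1 + `|r - 1| by have := ler_norm (r - 1); lra.
have h8 := normr_ge0 (r - 1).
rewrite mulrAC ler_pdivrMr //; nra.
Qed.

Lemma kern_bound (e : R) : sin (pi * e) != 0 -> exists2 K : R, 0 <= K &
  forall x, normc (kern (e +i* x)) <= K / (1 + expR (- (2 * pi * x))).
Proof.
move=> se; have s0 : 0 < `|sin (pi * e)| by rewrite normr_gt0.
exists (3 / `|sin (pi * e)|); first by rewrite divr_ge0 // ltW.
move=> x; rewrite /kern normcV.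
have p : 0 < 1 + expR (- (2 * pi * x)) by have := expR_gt0 (- (2 * pi * x)); lra.
have q : 0 < `|sin (pi * e)| / 3 * (1 + expR (- (2 * pi * x))).
  by rewrite mulr_gt0 // divr_gt0.
have -> : 3 / `|sin (pi * e)| / (1 + expR (- (2 * pi * x))) =
    (`|sin (pi * e)| / 3 * (1 + expR (- (2 * pi * x))))^-1.
  by field; rewrite !gt_eqF.
rewrite lef_pV2 ?posrE // ?kern_denominator_bound //.
by apply: lt_le_trans (kern_denominator_bound _ _).
Qed.

Lemma sin_pi_neq0 (e : R) : 0 < `|e| < 1 -> sin (pi * e) != 0.
Proof.
have key (z : R) : 0 < z < 1 -> sin (pi * z) != 0.
  move=> /andP[z0 z1]; rewrite gt_eqF // sin_gt0_pi //.
  by have := @pi_gt0 R => p; apply/andP; split; nra.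
have [e0|e0] := leP 0 e; first by rewrite (ger0_norm e0); exact: key.
rewrite (ltr0_norm e0) => /key; by rewrite mulrN sinN oppr_eq0.
Qed.

(** The decay rate is b as x -> +oo, where the denominator is at least 1, and 2 pi - b as x -> -oo,
    where it is at least exp (- 2 pi x). *)
Lemma kern_envelope (b x : R) : 0 < b < 2 * pi ->
  expR (- (b * x)) / (1 + expR (- (2 * pi * x))) <= gexp (Num.min b (2 * pi - b)) x.
Proof.
move=> /andP[b0 b2]; rewrite /gexp.
have l1 : Num.min b (2 * pi - b) <= b by rewrite ge_min lexx.
have l2 : Num.min b (2 * pi - b) <= 2 * pi - b by rewrite ge_min lexx orbT.
set l := Num.min _ _ in l1 l2 *.
have p := expR_gt0 (- (2 * pi * x)).
rewrite ler_pdivrMr; last by lra.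
have [x0|x0] := leP 0 x.
  rewrite ger0_norm //; apply: (@le_trans _ _ (expR (- l * x))).
    by rewrite ler_expR; nra.
  by rewrite ler_peMr ?expR_ge0 //; lra.
rewrite ltr0_norm //.
apply: (@le_trans _ _ (expR (- l * - x) * expR (- (2 * pi * x)))).
  by rewrite -expRD ler_expR; nra.
by rewrite ler_wpM2l ?expR_ge0 //; lra.
Qed.

Lemma cmeasurable_kern : cmeasurable (fun z : R * R => kern (z.1 +i* z.2)).
Proof.
rewrite /kern; apply: cmeasurableV; apply: cmeasurableB; last exact: cmeasurable_cst.
apply: cmeasurable_cexp; apply: cmeasurableM; first exact: cmeasurable_cst.
by apply: cmeasurable_complex; [exact: measurable_fst|exact: measurable_snd].
Qed.

End KernelBounds.

(** * The Fourier transform of the kernel *)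

(** Taylor formula for z |-> exp (c z) / (exp (tau z) - 1) under a shift by zeta: U and v are the
    two exponentials at the base point, B and A their growth factors. V measures the size of the
    denominators, so that the error is proportional to |U| / V, a function that [kern_envelope]
    makes integrable along the line. *)
Lemma second_order_quotient {R : realType} (U v tau c zeta A B : R[i]) (V K C h : R) :
  0 < V -> 0 <= K -> 0 <= C -> 0 <= h ->
  normc v <= V -> normc (v - 1) <= V ->
  V <= K * normc (v - 1) -> V <= K * normc (v * A - 1) ->
  normc (A - 1) <= C * h -> normc (B - 1) <= C * h ->
  normc (A - 1 - tau * zeta) <= C * h ^+ 2 ->
  normc (B - 1 - c * zeta) <= C * h ^+ 2 ->
  normc (U * B / (v * A - 1) - U / (v - 1)
         - zeta * (U * (c * (v - 1) - v * tau) / (v - 1) ^+ 2)) <=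
  (2 * C * K ^+ 2 + 2 * C ^+ 2 * K ^+ 3) * h ^+ 2 * (normc U / V).
Proof.
move=> V0 K0 C0 h0 vV dV dK DK A1 B1 A2 B2.
have inv_le z : V <= K * normc z -> z != 0 /\ normc z^-1 <= K / V.
  move=> zK; have z0 : 0 < normc z.
    by rewrite lt_neqAle normc_ge0 andbT eq_sym; apply: contraTneq zK => ->;
      rewrite mulr0 -ltNge.
  by rewrite -normc_eq0 gt_eqF // normcV ler_pdivlMr // mulrC ler_pdivrMr.
have [d0 dle] := inv_le _ dK; have [D0 Dle] := inv_le _ DK.
set d := v - 1 in d0 dle dV *; set D := v * A - 1 in D0 Dle *.
(* The exact increment is U N / (D d). Subtracting the linear part from N leaves [rho], and
   replacing 1 / D by 1 / d costs N (D - d) / (D d^2), where D - d = v (A - 1). *)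
pose rho := (B - 1 - c * zeta) * d - v * (A - 1 - tau * zeta).
pose N := (B - 1) * d - v * (A - 1).
have -> : U * B / D - U / d - zeta * (U * (c * d - v * tau) / d ^+ 2) =
    U * (rho * d^-1 ^+ 2 - N * (v * (A - 1)) * (D^-1 * d^-1 ^+ 2)).
  rewrite /rho /N; move: D0 d0; rewrite /D /d => D0 d0; field.
  by rewrite D0 d0.
rewrite normcM.
have nv := normc_ge0 v; have nd := normc_ge0 d.
have rho_le : normc rho <= 2 * C * h ^+ 2 * V.
  apply: le_trans (le_normcD _ _) _; rewrite normcN !normcM.
  have -> : 2 * C * h ^+ 2 * V = C * h ^+ 2 * V + V * (C * h ^+ 2) by ring.
  by apply: lerD; apply: ler_pM; rewrite ?normc_ge0.
have N_le : normc N <= 2 * C * h * V.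
  apply: le_trans (le_normcD _ _) _; rewrite normcN !normcM.
  have -> : 2 * C * h * V = C * h * V + V * (C * h) by ring.
  by apply: lerD; apply: ler_pM; rewrite ?normc_ge0.
have KV : 0 <= K / V by rewrite divr_ge0 // ltW.
have -> : (2 * C * K ^+ 2 + 2 * C ^+ 2 * K ^+ 3) * h ^+ 2 * (normc U / V) =
  normc U * (2 * C * h ^+ 2 * V * (K / V) ^+ 2 +
             2 * C * h * V * (V * (C * h)) * (K / V * (K / V) ^+ 2)).
  by field; rewrite gt_eqF.
rewrite ler_wpM2l ?normc_ge0 //.
apply: le_trans (le_normcD _ _) _; rewrite normcN !normcM.
have d2 : normc d^-1 * normc d^-1 <= (K / V) ^+ 2.
  by rewrite expr2; apply: ler_pM; rewrite ?normc_ge0.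
have n0 (z : R[i]) : 0 <= normc z by exact: normc_ge0.
apply: lerD.
  by apply: ler_pM => //; rewrite mulr_ge0.
by do ![apply: ler_pM | apply: mulr_ge0 | exact: n0 | assumption].
Qed.

(** * Independence of the transform from the contour *)

Section KernelTransform.
Context {R : realType}.
Local Notation mu := (@lebesgue_measure R).
Variable c : R[i].
Hypothesis c_im : 0 < complex.Im c < 2 * pi.

Let b := complex.Im c.
Let lam := Num.min b (2 * pi - b).

Let lam_gt0 : 0 < lam.
Proof. by move: c_im; rewrite -/b /lam lt_min subr_gt0. Qed.

Let q (e x : R) : R[i] := kern ((- e) +i* x) * cexp (c * ((- e) +i* x)).

Lemma normc_cexp_line (e x : R) :
  normc (cexp (c * (e +i* x))) = expR (complex.Re c * e) * expR (- (b * x)).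
Proof. by rewrite normc_cexp cReM /= expRB expRN. Qed.

Lemma cmeasurable_line (f : R[i] -> R[i]) (e : R) :
  cmeasurable (fun z : R * R => f (z.1 +i* z.2)) ->
  cmeasurable (fun x : R => f (e +i* x)).
Proof.
move=> mf; apply: (@cmeasurable_comp _ _ _ _ _ (fun x => (e, x)) _ mf).
exact: measurable_pair1.
Qed.

Lemma cmeasurable_cexp_line (w : R[i]) (e : R) :
  cmeasurable (fun x : R => cexp (w * (e +i* x))).
Proof.
apply: (cmeasurable_line (f := fun z => cexp (w * z))).
apply: cmeasurable_cexp; apply: cmeasurableM; first exact: cmeasurable_cst.
by apply: cmeasurable_complex; [exact: measurable_fst|exact: measurable_snd].
Qed.

Let mq e : cmeasurable (q e).
Proof.
apply: cmeasurableM; last exact: cmeasurable_cexp_line.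
exact: cmeasurable_line cmeasurable_kern.
Qed.

Lemma kern_transform_bound e : 0 < e < 1 -> exists2 K : R, 0 <= K &
  forall x, normc (q e x) <= K * gexp lam x.
Proof.
move=> /andP[e0 e1].
have [|K K0 HK] := @kern_bound R (- e).
  by apply: sin_pi_neq0; rewrite normrN gtr0_norm ?e0.
exists (K * expR (complex.Re c * - e)); first by rewrite mulr_ge0 ?expR_ge0.
move=> x; rewrite /q normcM normc_cexp_line.
apply: (@le_trans _ _ (K / (1 + expR (- (2 * pi * x))) *
   (expR (complex.Re c * - e) * expR (- (b * x))))).
  by apply: ler_wpM2r (HK x); rewrite mulr_ge0 ?expR_ge0.
have -> : K / (1 + expR (- (2 * pi * x))) *
  (expR (complex.Re c * - e) * expR (- (b * x))) =
  K * expR (complex.Re c * - e) * (expR (- (b * x)) / (1 + expR (- (2 * pi * x)))).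
  by ring.
by apply: ler_wpM2l; [rewrite mulr_ge0 ?expR_ge0 | exact: kern_envelope].
Qed.

Lemma kern_transform_integrable e : 0 < e < 1 -> cintegrable (q e).
Proof.
move=> /kern_transform_bound[K K0 HK]; apply: cintegrable_le HK _ => //.
by apply: rintegrableZ; have [] := rintegrable_gexp lam_gt0.
Qed.

(* With [g z = cexp (c * z) / (cexp (tau * z) - 1)], this is the Cauchy-Riemann
   relation [d g / d x = - 'i * d g / d y] up to a quadratic error. *)
Lemma kern_transform_cauchy_riemann e1 e2 : 0 < e1 -> e2 < 1 -> exists2 C : R, 0 <= C &
  forall e h x, e1 <= e -> 0 <= h <= 1 -> e + h <= e2 ->
    normc ((q (e + h) x - q e x) - 'i * (q e (x + h) - q e x)) <= C * h ^+ 2 * gexp lam x.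
Proof.
move=> e10 e21.
have [le12|lt21] := leP e1 e2; last first.
  by exists 0 => // e h x e1e /andP[h0 _] eh; exfalso; lra.
(* Compactness of [e1, e2], which avoids the poles at 0 and 1, makes the lower bound uniform in
   e. *)
have [m m0 Hm] : exists2 m : R, 0 < m & forall e, e1 <= e <= e2 -> m <= `|sin (pi * - e)|.
  have [|e0 /[!in_itv]/= /andP[e0l e0u] He0] :=
      @EVT_min R (fun e => sin (pi * e)) e1 e2 le12.
    apply: continuous_subspaceT => y; apply: continuous_comp.
      by apply: continuousM; [exact: cst_continuous|exact: id].
    exact: continuous_sin.
  exists (sin (pi * e0)).
    by have := @pi_gt0 R => p; apply: sin_gt0_pi; apply/andP; split; nra.
  move=> e ee; rewrite mulrN sinN normrN; apply: le_trans (ler_norm _).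
  by apply: He0; rewrite in_itv.
pose tau : R[i] := two_pi_i.
have orders (w : R[i]) : exists2 C : R, 0 <= C & forall h : R, 0 <= h <= 1 ->
    normc (cexp (w * h%:C) - 1) <= C * h /\
    normc (cexp (w * h%:C) - 1 - w * h%:C) <= C * h ^+ 2.
  have [C C0 HC] := cexp_second_order w; have [D D0 HD] := cexp_first_order w.
  exists (C + D); first by rewrite addr_ge0.
  move=> h h01; have /andP[h0 _] := h01; split.
    by apply: le_trans (HD h h01) _; rewrite ler_wpM2r // lerDr.
  by apply: le_trans (HC h h01) _; rewrite ler_wpM2r ?sqr_ge0 // lerDl.
(* The argument moves by - h when e grows by h, and by 'i h when x grows by h; each shift acts on
   both exponentials. *)
have [C1 C10 H1] := orders (- tau); have [C2 C20 H2] := orders (- c).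
have [C3 C30 H3] := orders (tau * 'i); have [C4 C40 H4] := orders (c * 'i).
pose C := C1 + C2 + C3 + C4.
(* 3 / m comes from [kern_denominator_bound]; exp (2 pi) absorbs the shift of x by at most 1, so
   that [V], taken at x, serves all the denominators. *)
pose K := 3 * expR (2 * pi) / m.
pose M := 2 * C * K ^+ 2 + 2 * C ^+ 2 * K ^+ 3.
have C0 : 0 <= C by rewrite /C !addr_ge0.
have K0 : 0 <= K by rewrite divr_ge0 ?mulr_ge0 ?expR_ge0 // ltW.
have M0 : 0 <= M by rewrite addr_ge0 // mulr_ge0 ?exprn_ge0 // mulr_ge0 ?exprn_ge0.
pose L := expR `|complex.Re c|.
exists (2 * M * L); first by rewrite !mulr_ge0 ?expR_ge0.
move=> e h x e1e h01 ehe2.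
have /andP[h0 h1] := h01.
have ee : e1 <= e <= e2 by rewrite e1e (le_trans _ ehe2) // lerDl.
have eeh : e1 <= e + h <= e2 by rewrite ehe2 (le_trans e1e) // lerDl.
have e0 : 0 <= e by rewrite (le_trans (ltW e10)).
have e_le1 : e <= 1 by case/andP: ee => _ /le_trans; apply; exact: ltW.
pose a : R[i] := (- e) +i* x.
pose U := cexp (c * a); pose v := cexp (tau * a).
pose V := 1 + expR (- (2 * pi * x)).
have nv : normc v = expR (- (2 * pi * x)).
  by rewrite /v /tau /a two_pi_iE normc_cexp.
have V0 : 0 < V by rewrite /V; have := expR_gt0 (- (2 * pi * x)); lra.
have E1 : 1 <= expR (2 * pi) :> R.
  by rewrite -(@expR0 R) ler_expR mulr_ge0 // pi_ge0.
have denom (f y : R) : e1 <= f <= e2 -> y <= 1 ->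
    V <= K * normc (cexp (tau * ((- f) +i* (x + y))) - 1).
  move=> ff y1; have := kern_denominator_bound (- f) (x + y).
  have := Hm f ff; set s := `|_|; set n := normc _ => ms hn.
  have hV : V <= expR (2 * pi) * (1 + expR (- (2 * pi * (x + y)))).
    rewrite /V [leRHS]mulrDr mulr1; apply: lerD => //.
    by rewrite -expRD ler_expR; have := @pi_gt0 R; nra.
  apply: le_trans hV _; rewrite /K.
  have p := expR_gt0 (- (2 * pi * (x + y))).
  have -> : 3 * expR (2 * pi) / m * n = expR (2 * pi) * (3 * n / m).
    by field; rewrite gt_eqF.
  rewrite ler_wpM2l ?expR_ge0 // ler_pdivlMr //; nra.
have leC (D t : R) : (D = C1 \/ D = C2 \/ D = C3 \/ D = C4) -> 0 <= t -> D * t <= C * t.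
  move=> HD t0; rewrite ler_wpM2r //.
  by case: HD => [->|[->|[->|->]]]; rewrite /C; clear -C10 C20 C30 C40; lra.
have h20 : 0 <= h ^+ 2 by exact: sqr_ge0.
have qE : q e x = U / (v - 1) by rewrite /q /kern mulrC.
have [a1 a2] := H1 h h01; have [b1 b2] := H2 h h01.
have [a3 a4] := H3 h h01; have [b3 b4] := H4 h h01.
pose Lin := U * (c * (v - 1) - v * tau) / (v - 1) ^+ 2.
have vV : normc v <= V by rewrite nv /V; lra.
have dV : normc (v - 1) <= V.
  by apply: le_trans (le_normcD _ _) _; rewrite normcN normc1 nv /V addrC.
have dK : V <= K * normc (v - 1).
  by have := denom e 0 ee ler01; rewrite addr0.
have q1E : q (e + h) x = U * cexp (- c * h%:C) / (v * cexp (- tau * h%:C) - 1).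
  rewrite /q /kern mulrC /U /v -!cexpD; congr (cexp _ / (cexp _ - 1));
    rewrite mulNr -mulrBr; congr (_ * _);
    by apply: complex_ext; rewrite /a /= ?opprD ?subr0.
have q2E : q e (x + h) = U * cexp (c * 'i * h%:C) / (v * cexp (tau * 'i * h%:C) - 1).
  rewrite /q /kern mulrC /U /v -!cexpD; congr (cexp _ / (cexp _ - 1));
    rewrite -mulrA -mulrDr; congr (_ * _);
    by apply: complex_ext; rewrite /a /=; ring.
have DK1 : V <= K * normc (v * cexp (- tau * h%:C) - 1).
  have := denom (e + h) 0 eeh ler01; rewrite addr0 => /le_trans; apply.
  rewrite /v -cexpD le_eqVlt; apply/orP; left; apply/eqP; congr (K * normc (cexp _ - 1)).
  by rewrite mulNr -mulrBr; congr (_ * _); apply: complex_ext; rewrite /a /= ?opprD ?subr0.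
have DK2 : V <= K * normc (v * cexp (tau * 'i * h%:C) - 1).
  apply: le_trans (denom e h ee h1) _.
  rewrite /v -cexpD le_eqVlt; apply/orP; left; apply/eqP; congr (K * normc (cexp _ - 1)).
  by rewrite -mulrA -mulrDr; congr (_ * _); apply: complex_ext; rewrite /a /=; ring.
have R1 : normc (q (e + h) x - q e x - (- h%:C) * Lin) <= M * h ^+ 2 * (normc U / V).
  rewrite q1E qE; apply: second_order_quotient => //.
  - by apply: le_trans a1 _; apply: leC => //; left.
  - by apply: le_trans b1 _; apply: leC => //; right; left.
  - by rewrite mulrN -mulNr; apply: le_trans a2 _; apply: leC => //; left.
  - by rewrite mulrN -mulNr; apply: le_trans b2 _; apply: leC => //; right; left.
have R2 : normc (q e (x + h) - q e x - ('i * h%:C) * Lin) <= M * h ^+ 2 * (normc U / V).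
  rewrite q2E qE; apply: second_order_quotient => //.
  - by apply: le_trans a3 _; apply: leC => //; do 2 right; left.
  - by apply: le_trans b3 _; apply: leC => //; do 3 right.
  - by rewrite mulrA; apply: le_trans a4 _; apply: leC => //; do 2 right; left.
  - by rewrite mulrA; apply: le_trans b4 _; apply: leC => //; do 3 right.
(* The linear terms cancel because 'i * ('i * h) = - h. *)
have -> : q (e + h) x - q e x - 'i * (q e (x + h) - q e x) =
    (q (e + h) x - q e x - (- h%:C) * Lin)
    - 'i * (q e (x + h) - q e x - ('i * h%:C) * Lin).
  have i2 : 'i * 'i = -1 :> R[i] by rewrite -expr2 sqr_i.
  have -> : 'i * (q e (x + h) - q e x - 'i * h%:C * Lin) =
      'i * (q e (x + h) - q e x) - 'i * 'i * (h%:C * Lin) by ring.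
  by rewrite i2; ring.
apply: le_trans (le_normcD _ _) _; rewrite normcN normcM normc_i mul1r.
apply: le_trans (lerD R1 R2) _.
have -> : 2 * M * L * h ^+ 2 * gexp lam x =
  M * h ^+ 2 * (L * gexp lam x) + M * h ^+ 2 * (L * gexp lam x) by ring.
have UV : normc U / V <= L * gexp lam x.
  rewrite /U /a normc_cexp_line -mulrA; apply: ler_pM; rewrite ?expR_ge0 //.
  - by rewrite divr_ge0 ?expR_ge0 // ltW.
  - rewrite ler_expR; apply: le_trans (ler_norm _) _; rewrite normrM normrN.
    by rewrite ler_piMr // ger0_norm.
  - exact: kern_envelope.
by apply: lerD; rewrite ler_wpM2l // mulr_ge0.
Qed.

(** By translation invariance q e (x + h) - q e x has integral 0. Subtracting 'i times it from the
    increment in e changes nothing after integration and leaves the Cauchy-Riemann defect, of order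
    h^2 with an integrable majorant. *)
Lemma kern_transform_cst e1 e2 : 0 < e1 -> e1 <= e2 -> e2 < 1 ->
  cintegral (q e1) = cintegral (q e2).
Proof.
move=> e10 e12 e21.
have [C C0 HC] := kern_transform_cauchy_riemann e10 e21.
have [ig Ig] := rintegrable_gexp lam_gt0.
apply: (@const_of_quadratic_increments R (fun e => cintegral (q e)) (2 * (C * (2 / lam)))) => //.
- by rewrite !mulr_ge0 // invr_ge0 ltW.
- lra.
move=> e h e1e h01 eh.
have h0 : 0 <= h by case/andP: h01.
have ie : cintegrable (q e) by apply: kern_transform_integrable; apply/andP; split; lra.
have ieh : cintegrable (q (e + h)).
  by apply: kern_transform_integrable; apply/andP; split; lra.
have [K K0 HK] : exists2 K : R, 0 <= K & forall x, normc (q e x) <= K * gexp lam x.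
  by apply: kern_transform_bound; apply/andP; split; lra.
have msh : cmeasurable (fun x : R => q e (x + h)).
  have mD : measurable_fun setT (fun x : R => x + h) by exact: measurable_funD.
  exact: cmeasurable_comp (mq e) mD.
have ish : cintegrable (fun x => q e (x + h)).
  apply: (@cintegrable_le _ _ (fun x => K * expR (lam * h) * gexp lam x)).
  - exact: msh.
  - move=> x; apply: le_trans (HK _) _; rewrite -mulrA ler_wpM2l //.
    rewrite /gexp -expRD ler_expR.
    have : `|x| <= `|x + h| + h.
      by have := ler_normB (x + h) h; rewrite addrK (ger0_norm h0).
    by have := lam_gt0; nra.
  - exact: rintegrableZ.
have -> : cintegral (q (e + h)) - cintegral (q e) =
    cintegral (fun x => (q (e + h) x - q e x) - 'i * (q e (x + h) - q e x)).
  rewrite cintegralB; first last.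
  - by apply: cintegrableZ; exact: cintegrableB.
  - exact: cintegrableB.
  rewrite cintegralZ; last exact: cintegrableB.
  rewrite !cintegralB // (cintegral_translation (mq e) ish) subrr mulr0 subr0 //.
apply: le_trans (cintegral_le (v := fun x => C * h ^+ 2 * gexp lam x) _ _ _) _.
- apply: cmeasurableB; first by apply: cmeasurableB; exact: mq.
  apply: cmeasurableM; first exact: cmeasurable_cst.
  by apply: cmeasurableB; last exact: mq.
- exact: rintegrableZ.
- by move=> x; exact: HC.
rewrite RintegralZl //.
have -> : 2 * (C * (2 / lam)) * h ^+ 2 = 2 * (C * h ^+ 2 * (2 / lam)) by ring.
by rewrite ler_wpM2l // ler_wpM2l // mulr_ge0 // sqr_ge0.
Qed.

End KernelTransform.

(** For t = y w z^j one has t^N = - y^N, so 1 / (t - 1) is a geometric sum in t divided by - (1 +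
    y^N). Summed over j, the powers z^(i j) cancel except for i = 0. *)
Lemma sum_inv_roots (F : fieldType) (N : nat) (w z y : F) :
  w ^+ N = -1 -> z ^+ N = 1 -> (forall n, (0 < n < N)%N -> z ^+ n != 1) ->
  1 + y ^+ N != 0 ->
  \sum_(j < N) (y * (w * z ^+ j) - 1)^-1 = - (N%:R / (1 + y ^+ N)).
Proof.
move=> wN zN zn yN.
have inv_geom (j : nat) : (y * (w * z ^+ j) - 1)^-1 =
    - (1 + y ^+ N)^-1 * \sum_(i < N) (y * (w * z ^+ j)) ^+ i.
  set t := y * _.
  have tN : t ^+ N = - y ^+ N.
    by rewrite !exprMn wN exprAC zN expr1n mulr1 mulrN1.
  have e := subrX1 t N; rewrite tN in e.
  have t1 : t - 1 != 0.
    apply: contraNneq yN => t1; rewrite t1 mul0r in e.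
    by rewrite -oppr_eq0 opprD addrC e.
  apply: (mulfI t1); rewrite mulfV // mulrCA -e.
  by rewrite mulNr -mulrN opprB opprK mulVf.
under eq_bigr do rewrite inv_geom.
rewrite -mulr_sumr exchange_big /=.
case: N wN zN zn yN {inv_geom} => [|N] wN zN zn yN; first by rewrite !big_ord0 mul0r mulr0 oppr0.
rewrite big_ord_recl /= [\sum_(i < N) _]big1 ?addr0; last first.
  move=> i _; rewrite /bump /= add1n.
  have zi : z ^+ i.+1 - 1 != 0.
    by rewrite subr_eq0 zn //= ltnS ltn_ord.
  under eq_bigr do rewrite !exprMn -exprM mulnC exprM mulrA.
  rewrite -mulr_sumr; apply/eqP; rewrite mulf_eq0; apply/orP; right.
  have := subrX1 (z ^+ i.+1) N.+1; rewrite exprAC zN expr1n subrr => /esym/eqP.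
  by rewrite mulf_eq0 (negbTE zi).
by under eq_bigr do rewrite expr0; rewrite sumr_const card_ord mulNr mulrC.
Qed.

(** * The Fourier integral over a half-line *)

Section HalfLine.
Context {R : realType}.
Local Notation mu := (@lebesgue_measure R).
Variable c : R[i].
Hypothesis c_im : 0 < complex.Im c.

Let E (x : R) : R[i] := cexp (c * 'i * x%:C).

Let normE x : normc (E x) = expR (- (complex.Im c * x)).
Proof.
rewrite /E normc_cexp; congr expR; case: (c) => u v /=.
by rewrite !(mulr0, mul0r, mulr1, addr0, sub0r, subr0) mulNr.
Qed.

Let ED x y : E (x + y) = E x * E y.
Proof. by rewrite /E rmorphD mulrDr cexpD. Qed.

Let mE : cmeasurable E.
Proof.
by apply: cmeasurable_cexp; apply: cmeasurableM; [exact: cmeasurable_cst|exact: cmeasurable_real].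
Qed.

Lemma cmeasurable_indic (A : set R) : measurable A -> cmeasurable (fun x : R => (\1_A x)%:C : R[i]).
Proof. by move=> mA; apply: cmeasurable_real; exact: measurable_indic. Qed.

Let f x : R[i] := (\1_(`]0, +oo[%classic : set R) x)%:C * E x.

Lemma half_line_bound x : normc (f x) <= gexp (complex.Im c) x.
Proof.
rewrite /f normcM normE normc_real indicE /gexp.
case: (boolP (x \in _)) => [|_] /=; last by rewrite normr0 mul0r expR_ge0.
rewrite normr1 mul1r ler_expR inE /= in_itv /= andbT => x0.
by rewrite gtr0_norm // mulNr.
Qed.

Lemma cmeasurable_half_line : cmeasurable f.
Proof. by apply: cmeasurableM => //; exact: cmeasurable_indic. Qed.

Lemma half_line_integrable : cintegrable f.
Proof.
apply: cintegrable_le half_line_bound _; first exact: cmeasurable_half_line.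
by have [] := rintegrable_gexp c_im.
Qed.

(** Instead of an antiderivative, the functional equation f (x + d) = E d (f x + h x) is integrated,
    where h is E cut off to ]- d, 0]. This gives T = E d (T + d + O(d^2)), and comparing the terms
    of first order in d yields c 'i T + 1 = 0. *)
Lemma half_line_integral : c * cintegral f = 'i.
Proof.
set T := cintegral f.
have [C1 C10 H1] := cexp_second_order (c * 'i).
have [C2 C20 H2] := cexp_first_order (c * 'i).
have [C3 C30 H3] := cexp_first_order (- (c * 'i)).
(* The four summands bound the errors r1 T, r2, r0 d and r0 r2 in [key] below, each divided by d^2
   (the last using d <= 1). *)
pose K := C1 * normc T + 2 * C3 + C2 + 2 * C2 * C3.
have K0 : 0 <= K by rewrite /K !addr_ge0 ?mulr_ge0 ?normc_ge0.
have step (n : nat) : (0 < n)%N -> normc (c * 'i * T + 1) <= K / n%:R.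
  move=> n0; pose d : R := n%:R^-1.
  have n1 : 1 <= n%:R :> R by rewrite ler1n.
  have d0 : 0 < d by rewrite invr_gt0 ltr0n.
  have d1 : d <= 1 by rewrite invf_le1 ?ltr0n.
  have d01 : 0 <= d <= 1 by rewrite ltW.
  pose B : set R := `]-d, 0]%classic.
  pose h x : R[i] := (\1_B x)%:C * E x.
  have ib : rintegrable (\1_B : R -> R) by exact: integrable_indic_itv.
  have IB : (\int[mu]_x (\1_B x : R))%R = d.
    have muB : (mu B = d%:E)%E.
      by rewrite /B lebesgue_measure_itv /= lte_fin ltrNl oppr0 d0 -EFinB sub0r opprK.
    have IB' : (\int[mu]_x (\1_B x)%:E = mu B)%E.
      by rewrite integral_indic ?setIT //; exact: measurable_itv.
    by rewrite /Rintegral IB' muB.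
  have hE1 x : normc ((\1_B x)%:C * (E x - 1)) <= C3 * d * \1_B x.
    rewrite normcM normc_real indicE; case: (boolP (x \in _)) => [|_] /=; last first.
      by rewrite normr0 mul0r mulr0.
    rewrite inE /B /= in_itv /= => /andP[xd x0]; rewrite normr1 mul1r mulr1.
    have := H3 (- x); rewrite oppr_ge0 x0 lerNl (le_trans _ (ltW xd)) ?lerN2 // => /(_ isT).
    rewrite rmorphN mulrNN => /le_trans; apply; rewrite ler_wpM2l //.
    by rewrite lerNl ltW.
  have mB : cmeasurable (fun x : R => (\1_B x)%:C : R[i]).
    by apply: cmeasurable_indic; exact: measurable_itv.
  have mE1 : cmeasurable (fun x => (\1_B x)%:C * (E x - 1)).
    by apply: cmeasurableM => //; apply: cmeasurableB => //; exact: cmeasurable_cst.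
  have iE1 : cintegrable (fun x => (\1_B x)%:C * (E x - 1)).
    by apply: cintegrable_le hE1 _ => //; exact: rintegrableZ.
  have iB : cintegrable (fun x : R => (\1_B x)%:C : R[i]).
    by split => //=; exact: integrable0.
  have CB : cintegral (fun x : R => (\1_B x)%:C : R[i]) = d%:C.
    by apply: complex_ext => /=; rewrite ?IB // Rintegral_cst // mul0r.
  pose r2 := cintegral (fun x => (\1_B x)%:C * (E x - 1)).
  have r2le : normc r2 <= 2 * (C3 * d * d).
    have ib' := rintegrableZ (C3 * d) ib.
    by have := cintegral_le mE1 ib' hE1; rewrite RintegralZl // IB.
  have hS : h = fun x => (\1_B x)%:C * (E x - 1) + (\1_B x)%:C.
    by apply/funext => x; rewrite /h; ring.
  have ih : cintegrable h by rewrite hS; exact: cintegrableD.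
  have Ih : cintegral h = r2 + d%:C by rewrite hS cintegralD // CB.
  have shift x : f (x + d) = E d * (f x + h x).
    rewrite /f /h ED -mulrDl -rmorphD.
    have -> : \1_(`]0, +oo[%classic : set R) (x + d) =
        \1_(`]0, +oo[%classic : set R) x + \1_B x :> R.
      rewrite !indicE /B !mem_setE !in_itv /= !andbT.
      have -> : (- d < x) = (0 < x + d) by rewrite -subr_gt0 opprK.
      have [x0|x0] := leP x 0; first by rewrite andbT add0r.
      by rewrite andbF addr0 addr_gt0.
    by ring.
  have mT : T = E d * (T + (r2 + d%:C)).
    rewrite -Ih /T -cintegralD //; last exact: half_line_integrable.
    rewrite -cintegralZ; last by apply: cintegrableD => //; exact: half_line_integrable.
    rewrite -(eq_cintegral shift) cintegral_translation //; first exact: cmeasurable_half_line.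
    rewrite (funext shift); apply: cintegrableZ; apply: cintegrableD => //.
    exact: half_line_integrable.
  have := H1 d d01; have := H2 d d01; rewrite -/(E d).
  set r0 := E d - 1; set r1 := r0 - _ => r0le r1le.
  have EdE : E d = 1 + r0 by rewrite /r0; ring.
  have key : d%:C * (c * 'i * T + 1) = - (r1 * T + r2 + r0 * d%:C + r0 * r2).
    have : 0 = (E d - 1) * T + E d * (r2 + d%:C).
      by rewrite mulrBl mul1r {2}mT; ring.
    rewrite EdE /r1 => e0; apply/eqP; rewrite -subr_eq0 opprK; apply/eqP.
    by rewrite [RHS]e0; ring.
  have : normc (d%:C * (c * 'i * T + 1)) <= d * (K * d).
    rewrite key normcN.
    apply: le_trans (le_normcD _ _) _.
    have -> : d * (K * d) = (C1 * d ^+ 2 * normc T + 2 * (C3 * d * d) + C2 * d * d)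
         + C2 * 1 * (2 * (C3 * d * d)) by rewrite /K; ring.
    have nn (z : R[i]) := normc_ge0 z.
    apply: lerD; last first.
      rewrite normcM; apply: ler_pM => //; apply: le_trans r0le _.
      by rewrite ler_wpM2l.
    apply: le_trans (le_normcD _ _) _; apply: lerD; last first.
      by rewrite normcM normc_real gtr0_norm // ler_wpM2r // ltW.
    apply: le_trans (le_normcD _ _) _; apply: lerD => //.
    by rewrite normcM ler_wpM2r.
  by rewrite normcM normc_real gtr0_norm // ler_pM2l.
have /eqP : normc (c * 'i * T + 1) = 0.
  apply/eqP; rewrite eq_le normc_ge0 andbT; exact: arch_le0 K0 step.
rewrite normc_eq0 => /eqP e0.
have i2 : 'i * 'i = -1 :> R[i] by rewrite -expr2 sqr_i.
have : 'i * (c * 'i * T + 1) = 0 by rewrite e0 mulr0.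
rewrite mulrDr mulr1; have -> : 'i * (c * 'i * T) = 'i * 'i * (c * T) by ring.
by rewrite i2 mulN1r => /eqP; rewrite addrC subr_eq0 => /eqP.
Qed.

End HalfLine.

(** * The value of the transform, by averaging over contours *)

Section KernelTransformValue.
Context {R : realType}.
Local Notation mu := (@lebesgue_measure R).
Variable c : R[i].
Hypothesis c_im : 0 < complex.Im c < 2 * pi.

Let b := complex.Im c.
Let b0 : 0 < b. Proof. by have /andP[] := c_im. Qed.
Let b2 : b < 2 * pi. Proof. by have /andP[] := c_im. Qed.

Let E (x : R) : R[i] := cexp (c * 'i * x%:C).

Let normE x : normc (E x) = expR (- (b * x)).
Proof.
rewrite /E normc_cexp /b; congr expR; case: (c) => u v /=.
by rewrite !(mulr0, mul0r, mulr1, addr0, sub0r, subr0) mulNr.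
Qed.

Let mE : cmeasurable E.
Proof.
by apply: cmeasurable_cexp; apply: cmeasurableM; [exact: cmeasurable_cst|exact: cmeasurable_real].
Qed.

Let rho (x : R) := expR (- (2 * pi * x)).

(** The averaged integrand: as N grows, its first factor tends to 1 for x > 0 and to 0 for x < 0. *)
Let X (N : nat) (x : R) : R[i] := ((1 + rho x ^+ N)^-1)%:C * E x.

Let T := cintegral (fun x => (\1_(`]0, +oo[%classic : set R) x)%:C * E x).

Let mrho : measurable_fun setT rho.
Proof.
apply: measurableT_comp; first exact: measurable_expR.
by apply: measurable_funN; exact: measurable_funM.
Qed.

Let mX N : cmeasurable (X N).
Proof.
apply: cmeasurableM => //.
have -> : (fun x => ((1 + rho x ^+ N)^-1)%:C : R[i]) = fun x => ((1 + rho x ^+ N)%:C)^-1.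
  by apply/funext => x; rewrite fmorphV.
apply/cmeasurableV/cmeasurable_real; apply: measurable_funD => //.
exact: measurable_funX.
Qed.

(** For x > 0 the factor differs from 1 by at most rho^N, for x <= 0 it is at most rho^(-N). Both
    beat exp (- b x) at a rate proportional to N, whence an integral of order 1 / N. *)
Let X_tail (N : nat) x : (0 < N)%N ->
  normc (X N x - (\1_(`]0, +oo[%classic : set R) x)%:C * E x)
  <= gexp ((2 * pi - b) * N%:R) x.
Proof.
move=> N0; rewrite /X -mulrBl -rmorphB normcM normc_real normE.
have N1 : 1 <= N%:R :> R by rewrite ler1n.
have rN : rho x ^+ N = expR (- (2 * pi * x * N%:R)) by rewrite -expRM_natr mulNr.
set r := rho x ^+ N in rN *.
have r0 : 0 < r by rewrite rN expR_gt0.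
have p0 := @pi_gt0 R.
rewrite indicE; case: (boolP (x \in _)).
  rewrite inE /= in_itv /= andbT => x0.
  rewrite -[true%:R]/(1%:R).
  have -> : (1 + r)^-1 - 1%:R = - (r / (1 + r)) by field; rewrite gt_eqF //; lra.
  rewrite normrN ger0_norm; last by rewrite divr_ge0 //; lra.
  apply: (@le_trans _ _ (r * expR (- (b * x)))).
    have h : r / (1 + r) <= r.
      by rewrite ler_pdivrMr; [rewrite mulrDr mulr1 lerDl mulr_ge0 // ltW | lra].
    by rewrite ler_wpM2r ?expR_ge0.
  rewrite rN -expRD ler_expR gtr0_norm //.
  have : 0 <= b * x * (N%:R + 1) by rewrite !mulr_ge0 ?addr_ge0 // ltW.
  lra.
rewrite notin_setE /= in_itv /= andbT => /negP; rewrite -leNgt => x0.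
rewrite subr0 ger0_norm; last by rewrite invr_ge0; lra.
apply: (@le_trans _ _ (r^-1 * expR (- (b * x)))).
  by rewrite ler_wpM2r ?expR_ge0 // lef_pV2 ?posrE; lra.
rewrite rN -expRN opprK -expRD ler_expR ler0_norm //.
have : 0 <= b * - x * (N%:R - 1) by rewrite !mulr_ge0 //; have := b0; lra.
lra.
Qed.

Let X_integrable N : (0 < N)%N -> cintegrable (X N).
Proof.
move=> N0; have iT := half_line_integrable b0.
have N0' : 0 < N%:R :> R by rewrite ltr0n.
have -> : X N = fun x => (X N x - (\1_(`]0, +oo[%classic : set R) x)%:C * E x) +
    (\1_(`]0, +oo[%classic : set R) x)%:C * E x by apply/funext => x; rewrite subrK.
apply: cintegrableD => //.
apply: cintegrable_le (fun x => X_tail x N0) _.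
  by apply: cmeasurableB => //; exact: cmeasurable_half_line.
have l0 : 0 < (2 * pi - b) * N%:R by rewrite mulr_gt0 // subr_gt0.
by have [] := rintegrable_gexp l0.
Qed.

Let X_limit N : (0 < N)%N ->
  normc (cintegral (X N) - T) <= 4 / (2 * pi - b) / N%:R.
Proof.
move=> N0; have iT := half_line_integrable b0.
have N0' : 0 < N%:R :> R by rewrite ltr0n.
have l0 : 0 < (2 * pi - b) * N%:R by rewrite mulr_gt0 // subr_gt0.
have [ig Ig] := rintegrable_gexp l0.
rewrite /T -cintegralB //; last exact: X_integrable.
apply: le_trans (cintegral_le _ ig (fun x => X_tail x N0)) _.
  by apply: cmeasurableB => //; exact: cmeasurable_half_line.
apply: (@le_trans _ _ (2 * (2 / ((2 * pi - b) * N%:R)))); first by rewrite ler_wpM2l.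
rewrite le_eqVlt; apply/orP; left; apply/eqP.
by rewrite invfM; ring.
Qed.

Let q (e x : R) : R[i] := kern ((- e) +i* x) * cexp (c * ((- e) +i* x)).

(** Odd multiples of 1 / (2 N) stay inside ]0, 1[, away from the poles, and turn the N-th powers of
    the exponentials into -1. The resulting denominator 1 + rho^N never vanishes. *)
Let midpoint (N j : nat) : R := (j%:R *+ 2 + 1) / (N%:R *+ 2).

Lemma half_complex : (2 : R[i])^-1 = (2^-1)%:C.
Proof. by rewrite fmorphV rmorph_nat. Qed.

Lemma cexp_natl (n : nat) (z : R[i]) : cexp z ^+ n = cexp (n%:R%:C * z).
Proof. by rewrite cexpX rmorph_nat mulr_natl. Qed.

Lemma kern_midpoint_sum (N : nat) (x : R) : (0 < N)%N ->
  \sum_(j < N) kern ((- midpoint N j) +i* x) =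
  - N%:R * ((1 + rho x ^+ N)^-1)%:C.
Proof.
move=> N0.
have N0' : 0 < N%:R :> R by rewrite ltr0n.
have N0n : N%:R != 0 :> R by rewrite gt_eqF.
pose tau : R[i] := two_pi_i.
pose w := cexp (tau * (- (N%:R *+ 2)^-1)%:C).
pose z := cexp (tau * (- N%:R^-1)%:C).
have zn n : z ^+ n = cexp (tau * (- (n%:R / N%:R))%:C).
  rewrite /z cexp_natl mulrCA -rmorphM; congr (cexp (_ * _%:C)).
  by rewrite mulrN.
have ker (j : 'I_N) : kern ((- midpoint N j) +i* x) = ((rho x)%:C * (w * z ^+ j) - 1)^-1.
  rewrite /kern zn; congr (_ - 1)^-1.
  have -> : (- midpoint N j) +i* x = 'i * x%:C + (- midpoint N j)%:C.
    by apply: complex_ext => /=; ring.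
  rewrite mulrDr cexpD; congr (_ * _).
    have -> : two_pi_i * ('i * x%:C) = (- (2 * pi * x))%:C :> R[i].
      by apply: complex_ext => /=; ring.
    by rewrite /cexp /= cos0 sin0 mulr1 mulr0.
  rewrite /w -cexpD -mulrDr -rmorphD; congr (cexp (_ * _%:C)).
  by rewrite /midpoint !mulr2n; field; rewrite N0n -mulr2n mulrn_eq0.
have z1 : z ^+ N = 1.
  rewrite zn divff // /tau -[(-1)%:C]/((-1) +i* 0) two_pi_iE /cexp /= mulr0 oppr0.
  rewrite expR0 !mul1r mulrN1 cosN sinN.
  by rewrite -[2 * pi]/(2%:R * pi) mulr_natl cos2pi sin2pi oppr0.
have w1 : w ^+ N = -1.
  have -> : w ^+ N = cexp (tau * (- 2^-1)%:C).
    rewrite /w cexp_natl mulrCA -rmorphM; congr (cexp (_ * _%:C)).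
    by rewrite !mulr2n; field; rewrite gt_eqF // addr_gt0.
  rewrite /tau -[(- 2^-1)%:C]/((- 2^-1) +i* 0) two_pi_iE /cexp /= mulr0 oppr0 expR0 !mul1r.
  have -> : 2 * pi * - 2^-1 = - (2 * 2^-1 * pi) :> R by ring.
  rewrite divff // mul1r cosN sinN cospi sinpi.
  by apply: complex_ext; rewrite /= ?oppr0.
have zn1 n : (0 < n < N)%N -> z ^+ n != 1.
  move=> /andP[n0 nN]; rewrite zn -subr_eq0 -normc_eq0 normc_cexp_sub1.
  rewrite mulf_neq0 // normr_eq0; apply: sin_pi_neq0.
  by rewrite normrN gtr0_norm ?divr_gt0 ?ltr0n //= ltr_pdivrMr // mul1r ltr_nat.
have r0 : 1 + rho x ^+ N != 0 by rewrite gt_eqF // ltr_pwDl // exprn_ge0 // expR_ge0.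
have r0c : 1 + ((rho x)%:C : R[i]) ^+ N = (1 + rho x ^+ N)%:C.
  by rewrite rmorphD rmorph1 rmorphXn.
under eq_bigr do rewrite ker.
rewrite (sum_inv_roots w1 z1 zn1); last by rewrite r0c fmorph_eq0.
by rewrite r0c mulNr fmorphV.
Qed.

(** Moving the contour to the j-th midpoint e_j and multiplying by exp (c e_j) leaves the factor
    [E x], the same for all j, so only the kernels remain to be summed. *)
Let average e N : 0 < e < 1 -> (0 < N)%N ->
  cintegral (q e) * \sum_(j < N) cexp (c * ((j%:R *+ 2 + 1) / (N%:R *+ 2))%:C) =
  - N%:R * cintegral (X N).
Proof.
move=> e01 N0.
have N0' : 0 < N%:R :> R by rewrite ltr0n.
pose ej (j : nat) : R := midpoint N j.
have N2 : 0 < N%:R *+ 2 :> R by rewrite pmulrn_lgt0.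
have ej01 (j : 'I_N) : 0 < ej j < 1.
  have jN : j.+1%:R <= N%:R :> R by rewrite ler_nat.
  have j0 : 0 <= j%:R :> R by [].
  rewrite /ej /midpoint divr_gt0 ?ltr_wpDl ?mulrn_wge0 //= ltr_pdivrMr // mul1r.
  by move: jN; rewrite -natr1 !mulr2n; lra.
have term (j : 'I_N) : cintegral (q e) * cexp (c * (ej j)%:C) =
    cintegral (fun x => kern ((- ej j) +i* x) * E x).
  have -> : cintegral (q e) = cintegral (q (ej j)).
    have /andP[e0 e1] := e01; have /andP[f0 f1] := ej01 j.
    have [ef|/ltW fe] := leP e (ej j); first exact: (kern_transform_cst c_im).
    by symmetry; exact: (kern_transform_cst c_im).
  rewrite mulrC -cintegralZ; last exact: (kern_transform_integrable c_im).
  apply: eq_cintegral => x; rewrite /q /E mulrCA -cexpD; congr (_ * cexp _).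
  by rewrite -mulrA -mulrDr; congr (_ * _); apply: complex_ext => /=; ring.
have iterm (j : 'I_N) : cintegrable (fun x => kern ((- ej j) +i* x) * E x).
  have -> : (fun x => kern ((- ej j) +i* x) * E x) =
      fun x => cexp (c * (ej j)%:C) * q (ej j) x.
    apply/funext => x; rewrite /q /E mulrCA -cexpD; congr (_ * cexp _).
    by rewrite -mulrA -mulrDr; congr (_ * _); apply: complex_ext => /=; ring.
  by apply: cintegrableZ; exact: (kern_transform_integrable c_im).
rewrite mulr_sumr; under eq_bigr do rewrite term.
have [_ <-] := cintegral_sum (index_enum 'I_N) iterm.
rewrite -cintegralZ; last exact: X_integrable.
apply: eq_cintegral => x; rewrite -mulr_suml /X mulrA; congr (_ * _).
exact: kern_midpoint_sum.
Qed.

(** Summing the geometric series on the left of [average] gives A exp (c / (2 n)) = - n (g - 1)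
    times the integral of [X n], with g = exp (c / n). In the limit n (g - 1) becomes c and the
    integral becomes T, so A = - c T = - 'i. *)
Lemma kern_transform_value e : 0 < e < 1 ->
  'i * cintegral (q e) = (cexp c - 1)^-1.
Proof.
move=> e01; set J := cintegral (q e).
have cT : c * T = 'i by exact: half_line_integral b0.
have [C1 C10 H1] := cexp_second_order c.
have [C2 C20 H2] := cexp_first_order (c / 2).
pose C3 := 4 / (2 * pi - b).
have C30 : 0 <= C3 by rewrite divr_ge0 // subr_ge0 ltW.
pose A := J * (cexp c - 1).
(* One summand for each error in [key]: r0 A, n r1 T, c r2 and n r1 r2. *)
pose K := C2 * normc A + C1 * normc T + normc c * C3 + C1 * C3.
have K0 : 0 <= K.
  rewrite /K; apply: addr_ge0; [apply: addr_ge0; [apply: addr_ge0|]|];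
    apply: mulr_ge0 => //; exact: normc_ge0.
have nn (z : R[i]) := normc_ge0 z.
have step (n : nat) : (0 < n)%N -> normc (A + c * T) <= K / n%:R.
  move=> n0; pose d : R := n%:R^-1.
  have n1 : 1 <= n%:R :> R by rewrite ler1n.
  have n0' : 0 < n%:R :> R by rewrite ltr0n.
  have d0 : 0 < d by rewrite invr_gt0 ltr0n.
  have d1 : d <= 1 by rewrite invf_le1 ?ltr0n.
  have d01 : 0 <= d <= 1 by rewrite ltW.
  have nd : n%:R * d%:C = 1 :> R[i].
    by rewrite -(rmorph_nat (real_complex R)) -rmorphM mulfV ?gt_eqF // rmorph1.
  have avg := average e01 n0; rewrite -/J in avg.
  pose g := cexp (c * d%:C).
  have geo : (g - 1) * \sum_(j < n) cexp (c * ((j%:R *+ 2 + 1) / (n%:R *+ 2))%:C) =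
      cexp (c / 2 * d%:C) * (cexp c - 1).
    have -> : cexp c = g ^+ n.
      by rewrite /g cexpX -[_ *+ n]mulr_natl mulrCA nd mulr1.
    rewrite subrX1 mulrCA; congr (_ * _); rewrite mulr_sumr; apply: eq_bigr => j _.
    rewrite /g cexp_natl -cexpD; congr cexp.
    have -> : c / 2 * d%:C = c * (2^-1 * d)%:C.
      by rewrite half_complex -mulrA -rmorphM.
    rewrite mulrCA -mulrDr -rmorphM -rmorphD; congr (_ * _%:C).
    by rewrite /d !mulr2n; field; rewrite gt_eqF //= gt_eqF // addr_gt0.
  have main : A * cexp (c / 2 * d%:C) = - (n%:R * (g - 1)) * cintegral (X n).
    have -> : A * cexp (c / 2 * d%:C) = J * (cexp (c / 2 * d%:C) * (cexp c - 1)).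
      by rewrite /A; ring.
    by rewrite -geo mulrCA avg; ring.
  have := H1 d d01; have := H2 d d01; rewrite -/g.
  set r0 := cexp _ - 1; set r1 := g - 1 - c * d%:C => r0le r1le.
  have r2le := X_limit n0; set r2 := cintegral (X n) - T in r2le.
  have key : A + c * T = - (r0 * A + n%:R * r1 * T + c * r2 + n%:R * r1 * r2).
    have e0 : A * (r0 + 1) = - (n%:R * (r1 + c * d%:C)) * (r2 + T).
      by rewrite /r0 /r1 /r2 !subrK.
    have e1 : n%:R * (r1 + c * d%:C) = n%:R * r1 + c.
      by rewrite mulrDr [n%:R * (c * _)]mulrCA nd mulr1.
    rewrite e1 in e0; apply/eqP; rewrite -subr_eq0 opprK; apply/eqP.
    have -> : A + c * T + (r0 * A + n%:R * r1 * T + c * r2 + n%:R * r1 * r2) =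
      A * (r0 + 1) + (n%:R * r1 + c) * (r2 + T) by ring.
    by rewrite e0; ring.
  have nr1 : normc (n%:R * r1) <= C1 * d.
    rewrite -(rmorph_nat (real_complex R)) normcM normc_real gtr0_norm //.
    have -> : C1 * d = n%:R * (C1 * d ^+ 2) by rewrite /d; field; rewrite gt_eqF.
    by rewrite ler_wpM2l // ltW.
  have r2le' : normc r2 <= C3 * d by [].
  rewrite key normcN.
  have -> : K / n%:R = C2 * d * normc A + C1 * d * normc T + normc c * (C3 * d)
      + C1 * 1 * (C3 * d).
    by rewrite /K /d; ring.
  apply: le_trans (le_normcD _ _) _; apply: lerD; last first.
    by rewrite normcM; apply: ler_pM => //; apply: le_trans nr1 _; rewrite ler_wpM2l.
  apply: le_trans (le_normcD _ _) _; apply: lerD; last first.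
    by rewrite normcM; apply: ler_pM.
  apply: le_trans (le_normcD _ _) _; apply: lerD.
    by rewrite normcM; apply: ler_pM.
  by rewrite normcM; apply: ler_pM.
have /eqP : normc (A + c * T) = 0.
  apply/eqP; rewrite eq_le normc_ge0 andbT; exact: arch_le0 K0 step.
rewrite normc_eq0 cT addr_eq0 => /eqP e0.
have i2 : 'i * 'i = -1 :> R[i] by rewrite -expr2 sqr_i.
have e1 : 'i * J * (cexp c - 1) = 1 by rewrite -mulrA -/A e0 mulrN i2 opprK.
have n0 : cexp c - 1 != 0.
  by apply: contra_eq_neq e1 => ->; rewrite mulr0 eq_sym oner_neq0.
by apply: (mulIf n0); rewrite e1 mulVf.
Qed.

End KernelTransformValue.

(** * Words as operators *)

Section WordOperators.
Context {R : realType}.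
Local Notation mu := (@lebesgue_measure R).
Variable omega : R.
Hypothesis omega_gt0 : 0 < omega.

(** Up to a power of hbar this is I_omega (g_1 | s). It is the kernel rescaled by - omega, so one
    set of bounds serves both operations. *)
Definition weight (s : R[i]) : R[i] := kern (- (omega%:C * s)).

Definition wave (s p : R[i]) : R[i] := cexp (- (two_pi_i * omega%:C * s * p)).

(* A word is read as an operator: [true] is the convolution with [kern],
   [false] the multiplication by [weight]. *)
Fixpoint op (e : R) (v : seq bool) (H : R[i] -> R[i]) (s : R[i]) : R[i] :=
  match v with
  | [::] => H s
  | true :: v' => line_integral e (fun t => kern t * op e v' H (s + t))
  | false :: v' => weight s * op e v' H s
  end.

(** The bound in x is one-sided: growth as x -> -oo is allowed, since the kernel compensates it when
    m < 2 pi. The second variable is a parameter; its own rate k is what Fubini needs when this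
    parameter is integrated against another kernel. *)
Definition exp_dominated (m k c : R) (H : R[i] -> R -> R[i]) :=
  cmeasurable (fun z : R * R => H (c +i* z.1) z.2) /\
  exists2 A : R, 0 <= A &
    forall x y, normc (H (c +i* x) y) <= A * (expR (- (m * x)) * expR (- (k * y))).

(** Here c is the real part of the argument: each convolution lowers it by e, and each
    multiplication must take place off the poles of [weight]. *)
Fixpoint admissible (e c : R) (v : seq bool) : Prop :=
  match v with
  | [::] => True
  | true :: v' => admissible e (c - e) v'
  | false :: v' => 0 < `|omega * c| < 1 /\ admissible e c v'
  end.

Lemma weightE s : weight s = (cexp (- (two_pi_i * omega%:C * s)) - 1)^-1.
Proof. by rewrite /weight /kern mulrN mulrA. Qed.

Lemma weight_line (c x : R) :
  weight (c +i* x) = kern ((- (omega * c)) +i* (- (omega * x))).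
Proof. by rewrite /weight; congr kern; apply: complex_ext => /=; ring. Qed.

Lemma addc_line (c e x y : R) : (c +i* x) + ((- e) +i* y) = (c - e) +i* (x + y).
Proof. by []. Qed.

Lemma cmeasurable_weight (c : R) : cmeasurable (fun x : R => weight (c +i* x)).
Proof.
under eq_fun do rewrite weight_line.
apply: (cmeasurable_comp (cmeasurable_line (- (omega * c)) cmeasurable_kern)).
by apply: measurable_funN; exact: measurable_funM.
Qed.

(** The rate m = 0 is boundedness, enough for multiplications inside a word; m > 0 is what the last
    a of a word provides. *)
Lemma weight_decay (c m : R) : 0 < `|omega * c| < 1 -> 0 <= m <= 2 * pi * omega ->
  exists2 K : R, 0 <= K & forall x, normc (weight (c +i* x)) <= K * expR (- (m * x)).
Proof.
move=> hc /andP[m0 m1].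
have [|K K0 HK] := @kern_bound R (- (omega * c)).
  by apply: sin_pi_neq0; rewrite normrN.
exists K => // x; rewrite weight_line; apply: le_trans (HK _) _.
rewrite ler_wpM2l // mulrN opprK expRN.
rewrite lef_pV2 ?posrE ?expR_gt0 ?ltr_pwDl ?expR_ge0 //.
have [x0|x0] := leP 0 x.
  apply: ler_wpDl => //; rewrite ler_expR mulrA ler_wpM2r //.
apply: (@le_trans _ _ 1); last by rewrite lerDl expR_ge0.
by rewrite -[leRHS](@expR0 R) ler_expR; nra.
Qed.

Lemma kern_line_bound (e m : R) : 0 < e < 1 -> 0 < m < 2 * pi ->
  exists2 K : R, 0 <= K & forall x,
    normc (kern ((- e) +i* x)) * expR (- (m * x)) <= K * gexp (Num.min m (2 * pi - m)) x.
Proof.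
move=> /andP[e0 e1] hm.
have [|K K0 HK] := @kern_bound R (- e).
  by apply: sin_pi_neq0; rewrite normrN gtr0_norm ?e0.
exists K => // x; apply: le_trans (ler_wpM2r (expR_ge0 _) (HK x)) _.
rewrite mulrAC -mulrA ler_wpM2l //.
exact: kern_envelope.
Qed.

Lemma min_gt0 (m : R) : 0 < m < 2 * pi -> 0 < Num.min m (2 * pi - m).
Proof. by rewrite lt_min subr_gt0. Qed.

(** Since exp (- m (x + x')) factors, a convolution reproduces the bound in x while its integration
    variable x' gets an integrable majorant. *)
Lemma exp_dominated_kern_bound (e m k c : R) H : 0 < e < 1 -> 0 < m < 2 * pi ->
  exp_dominated m k c H -> exists2 B : R, 0 <= B & forall x' x y,
    normc (kern ((- e) +i* x') * H (c +i* (x + x')) y) <=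
    B * gexp (Num.min m (2 * pi - m)) x' * (expR (- (m * x)) * expR (- (k * y))).
Proof.
move=> he hm [_ [A A0 HA]]; have [K K0 HK] := kern_line_bound he hm.
exists (A * K); first by rewrite mulr_ge0.
move=> x' x y; rewrite normcM.
apply: (@le_trans _ _ (normc (kern ((- e) +i* x')) *
   (A * (expR (- (m * (x + x'))) * expR (- (k * y)))))).
  by rewrite ler_wpM2l ?normc_ge0.
have -> : expR (- (m * (x + x'))) = expR (- (m * x')) * expR (- (m * x)).
  by rewrite -expRD; congr expR; ring.
have -> : normc (kern ((- e) +i* x')) * (A * (expR (- (m * x')) * expR (- (m * x)) *
    expR (- (k * y)))) = normc (kern ((- e) +i* x')) * expR (- (m * x')) *
    (A * (expR (- (m * x)) * expR (- (k * y)))) by ring.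
have -> : A * K * gexp (Num.min m (2 * pi - m)) x' * (expR (- (m * x)) * expR (- (k * y))) =
    K * gexp (Num.min m (2 * pi - m)) x' * (A * (expR (- (m * x)) * expR (- (k * y)))) by ring.
by rewrite ler_wpM2r // !mulr_ge0 ?expR_ge0.
Qed.

Lemma cmeasurable_kern_line e : cmeasurable (fun x : R => kern ((- e) +i* x)).
Proof. exact: cmeasurable_line cmeasurable_kern. Qed.

Lemma exp_dominated_measurable_shift (m k c : R) H : exp_dominated m k c H ->
  cmeasurable (fun z : (R * R) * R => H (c +i* (z.1.1 + z.2)) z.1.2).
Proof.
move=> [mH _].
have mg : measurable_fun setT (fun z : (R * R) * R => (z.1.1 + z.2, z.1.2)).
  apply: measurable_fun_pair; last first.
    exact: (measurableT_comp measurable_snd measurable_fst).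
  apply: measurable_funD; last exact: measurable_snd.
  exact: (measurableT_comp measurable_fst measurable_fst).
exact: (cmeasurable_comp mH mg).
Qed.

Lemma exp_dominated_kern_measurable (e m k c : R) H : exp_dominated m k c H ->
  cmeasurable (fun z : (R * R) * R =>
    kern ((- e) +i* z.2) * H (c +i* (z.1.1 + z.2)) z.1.2).
Proof.
move=> gH; apply: cmeasurableM; last exact: exp_dominated_measurable_shift gH.
exact: (cmeasurable_comp (cmeasurable_kern_line e) (@measurable_snd _ _ (R * R)%type R)).
Qed.

Lemma exp_dominated_kern_integrable (e m k c x y : R) H : 0 < e < 1 -> 0 < m < 2 * pi ->
  exp_dominated m k c H -> cintegrable (fun x' => kern ((- e) +i* x') * H (c +i* (x + x')) y).
Proof.
move=> he hm gH; have [B B0 HB] := exp_dominated_kern_bound he hm gH.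
have [ig _] := rintegrable_gexp (min_gt0 hm).
apply: (@cintegrable_le _ _ (fun x' => (expR (- (m * x)) * expR (- (k * y)) * B) *
   gexp (Num.min m (2 * pi - m)) x')).
- have mp : measurable_fun setT (fun x' : R => ((x, y), x')) by exact: measurable_pair1.
  exact: (cmeasurable_comp (exp_dominated_kern_measurable e gH) mp).
- by move=> x'; apply: le_trans (HB x' x y) _; rewrite [leLHS]mulrC mulrA.
- exact: rintegrableZ.
Qed.

(** The form in which [count id (true :: v)] simplifies, with a coerced boolean. *)
Lemma natr_true n : (true + n)%:R = 1 + n%:R :> R.
Proof. by rewrite natrD. Qed.

Lemma line_step (e c : R) n : c - e * (true + n)%:R = c - e - e * n%:R.
Proof. by rewrite natr_true; ring. Qed.

Lemma op_true (e c x : R) v H : op e (true :: v) H (c +i* x) =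
  'i * cintegral (fun x' => kern ((- e) +i* x') * op e v H ((c - e) +i* (x + x'))).
Proof. by []. Qed.

Lemma op_exp_dominated (e m k c : R) v H : 0 < e < 1 -> 0 < m < 2 * pi ->
  admissible e c v -> exp_dominated m k (c - e * (count id v)%:R) H ->
  exp_dominated m k c (fun s y => op e v (H^~ y) s).
Proof.
move=> he hm; elim: v c => [|[] v ih] c /=.
- by rewrite mulr0 subr0.
- move=> av gH.
  have {}gH : exp_dominated m k (c - e - e * (count id v)%:R) H.
    by rewrite -line_step.
  have {ih} gv := ih (c - e) av gH.
  set G := fun s y => op e v (H^~ y) s in gv.
  have [B B0 HB] := exp_dominated_kern_bound he hm gv.
  have [ig Ig] := rintegrable_gexp (min_gt0 hm).
  split.
    apply: cmeasurableM; first exact: cmeasurable_cst.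
    exact: (cmeasurable_cintegral (exp_dominated_kern_measurable e gv)).
  exists (2 * (B * (2 / Num.min m (2 * pi - m)))).
    by rewrite !mulr_ge0 // invr_ge0 ltW // min_gt0.
  move=> x y; rewrite normcM normc_i mul1r.
  pose W := expR (- (m * x)) * expR (- (k * y)).
  have W0 : 0 <= W by rewrite mulr_ge0 ?expR_ge0.
  have iv := rintegrableZ (W * B) ig.
  have mp : measurable_fun setT (fun x' : R => ((x, y), x')) by exact: measurable_pair1.
  have := @cintegral_le R (fun x' => kern ((- e) +i* x') * G ((c - e) +i* (x + x')) y) _
    (cmeasurable_comp (exp_dominated_kern_measurable e gv) mp) iv.
  rewrite RintegralZl // => /(_ _)/le_trans; apply.
    by move=> x'; apply: le_trans (HB x' x y) _; rewrite [leLHS]mulrC mulrA.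
  have -> : 2 * (B * (2 / Num.min m (2 * pi - m))) * W =
     2 * (W * B * (2 / Num.min m (2 * pi - m))) by ring.
  by rewrite !ler_wpM2l // mulr_ge0.
- move=> [hc av] gH; have [mG [A A0 HA]] := ih c av gH.
  have [|K K0 HK] := @weight_decay c 0 hc.
    by rewrite lexx !mulr_ge0 ?pi_ge0 // ltW.
  split.
    apply: cmeasurableM => //.
    exact: (cmeasurable_comp (cmeasurable_weight c) (@measurable_fst _ _ R R)).
  exists (K * A); first by rewrite mulr_ge0.
  move=> x y; rewrite normcM -[leRHS]mulrA; apply: ler_pM; rewrite ?normc_ge0 //.
  by have := HK x; rewrite mul0r oppr0 expR0 mulr1.
Qed.

Lemma op_scale (e m c x : R) v H (a : R[i]) : 0 < e < 1 -> 0 < m < 2 * pi ->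
  admissible e c v -> exp_dominated m 0 (c - e * (count id v)%:R) (fun s _ => H s) ->
  op e v (fun p => a * H p) (c +i* x) = a * op e v H (c +i* x).
Proof.
move=> he hm; elim: v c x => [|[] v ih] c x //.
- rewrite [admissible _ _ _]/= [count _ _]/= => av gH.
  have {}gH : exp_dominated m 0 (c - e - e * (count id v)%:R) (fun s _ => H s).
    by rewrite -line_step.
  have gv := op_exp_dominated he hm av gH.
  rewrite !op_true [RHS]mulrCA; congr (_ * _); rewrite -cintegralZ; last first.
    exact: (exp_dominated_kern_integrable x 0 he hm gv).
  by apply: eq_cintegral => x'; rewrite ih // mulrCA.
- by move=> [hc av] gH /=; rewrite ih // mulrCA.
Qed.

Lemma eq_op_line (e c x : R) v H H' :
  (forall y, H ((c - e * (count id v)%:R) +i* y) = H' ((c - e * (count id v)%:R) +i* y)) ->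
  op e v H (c +i* x) = op e v H' (c +i* x).
Proof.
elim: v c x => [|[] v ih] c x.
- by rewrite /= mulr0 subr0.
- rewrite [count _ _]/= => HH; rewrite !op_true; congr (_ * _).
  apply: eq_cintegral => x'; congr (_ * _); apply: ih => y.
  by rewrite -line_step.
- by move=> HH /=; rewrite (ih c x).
Qed.

Lemma op_cat e v1 v2 H s : op e (v1 ++ v2) H s = op e v1 (op e v2 H) s.
Proof.
elim: v1 s => [|[] v1 ih] s //=; last by rewrite ih.
by congr (_ * _); apply: eq_cintegral => x; rewrite ih.
Qed.

Lemma exp_dominated_kern_integrable_snd (f m k c x : R) H : 0 < f < 1 -> 0 < k < 2 * pi ->
  exp_dominated m k c H -> cintegrable (fun y => kern ((- f) +i* y) * H (c +i* x) y).
Proof.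
move=> hf hk [mH [A A0 HA]]; have [K K0 HK] := kern_line_bound hf hk.
have [ig _] := rintegrable_gexp (min_gt0 hk).
apply: (@cintegrable_le _ _ (fun y => (A * expR (- (m * x)) * K) *
   gexp (Num.min k (2 * pi - k)) y)).
- apply: cmeasurableM; first exact: cmeasurable_kern_line.
  have mp : measurable_fun setT (fun y : R => (x, y)) by exact: measurable_pair1.
  exact: (cmeasurable_comp mH mp).
- move=> y; rewrite normcM.
  apply: le_trans (ler_wpM2l (normc_ge0 _) (HA x y)) _.
  have -> : normc (kern ((- f) +i* y)) * (A * (expR (- (m * x)) * expR (- (k * y)))) =
    A * expR (- (m * x)) * (normc (kern ((- f) +i* y)) * expR (- (k * y))) by ring.
  by rewrite -[leRHS]mulrA ler_wpM2l // mulr_ge0 ?expR_ge0.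
- exact: rintegrableZ.
Qed.

(** The word acts on p, the outer kernel on the parameter y. Each convolution in v is exchanged with
    the y-integral by Fubini, with a product of two functions [gexp] as majorant; multiplications
    are scalars for the y-integral. *)
Lemma op_swap (e f m k c x : R) v H : 0 < e < 1 -> 0 < f < 1 ->
  0 < m < 2 * pi -> 0 < k < 2 * pi ->
  admissible e c v -> exp_dominated m k (c - e * (count id v)%:R) H ->
  op e v (fun p => 'i * cintegral (fun y => kern ((- f) +i* y) * H p y)) (c +i* x) =
  'i * cintegral (fun y => kern ((- f) +i* y) * op e v (H^~ y) (c +i* x)).
Proof.
move=> he hf hm hk; elim: v c x => [|[] v ih] c x //.
- rewrite [admissible _ _ _]/= [count _ _]/= => av gH.
  have {}gH : exp_dominated m k (c - e - e * (count id v)%:R) H by rewrite -line_step.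
  have gv := op_exp_dominated he hm av gH.
  set G := fun s y => op e v (H^~ y) s in gv.
  pose Phi (z : R * R) := 'i * (kern ((- e) +i* z.1) *
    (kern ((- f) +i* z.2) * G ((c - e) +i* (x + z.1)) z.2)).
  rewrite op_true; congr (_ * _).
  transitivity (cintegral (fun x' => cintegral (fun y => Phi (x', y)))).
    apply: eq_cintegral => x'; rewrite ih // mulrCA mulrA -cintegralZ; last first.
      exact: (exp_dominated_kern_integrable_snd _ hf hk gv).
    by apply: eq_cintegral => y; rewrite /Phi /G /=; ring.
  transitivity (cintegral (fun y => cintegral (fun x' => Phi (x', y)))); last first.
    apply: eq_cintegral => y; rewrite op_true mulrA -cintegralZ; last first.
      exact: (exp_dominated_kern_integrable x y he hm gv).
    by apply: eq_cintegral => x'; rewrite /Phi /G /=; ring.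
  have [B B0 HB] := exp_dominated_kern_bound he hm gv; have [K K0 HK] := kern_line_bound hf hk.
  have [igm _] := rintegrable_gexp (min_gt0 hm).
  have [igk _] := rintegrable_gexp (min_gt0 hk).
  apply: (@cintegral_fubini _ Phi
    (fun x' => (B * expR (- (m * x))) * gexp (Num.min m (2 * pi - m)) x')
    (fun y => K * gexp (Num.min k (2 * pi - k)) y)).
  + apply: cmeasurableM; first exact: cmeasurable_cst.
    apply: cmeasurableM.
      exact: (cmeasurable_comp (cmeasurable_kern_line e) (@measurable_fst _ _ R R)).
    apply: cmeasurableM.
      exact: (cmeasurable_comp (cmeasurable_kern_line f) (@measurable_snd _ _ R R)).
    have mg : measurable_fun setT (fun z : R * R => (x + z.1, z.2)).
      apply: measurable_fun_pair; last exact: measurable_snd.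
      by apply: measurable_funD; [exact: measurable_cst|exact: measurable_fst].
    exact: (cmeasurable_comp gv.1 mg).
  + exact: rintegrableZ.
  + exact: rintegrableZ.
  + move=> x' y; rewrite /Phi /= normcM normc_i mul1r mulrCA normcM.
    apply: le_trans (ler_wpM2l (normc_ge0 _) (HB x' x y)) _.
    set g := gexp (Num.min m _) x'; set n := normc _.
    have -> : n * (B * g * (expR (- (m * x)) * expR (- (k * y)))) =
      B * expR (- (m * x)) * g * (n * expR (- (k * y))) by ring.
    apply: ler_wpM2l; last exact: HK.
    by do ![apply: mulr_ge0 | exact: expR_ge0 | assumption].
- move=> [hc av] gH /=; rewrite ih // mulrCA -cintegralZ; last first.
    exact: (exp_dominated_kern_integrable_snd _ hf hk (op_exp_dominated he hm av gH)).
  by congr (_ * _); apply: eq_cintegral => y; rewrite mulrCA.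
Qed.

(** * The waves exchange convolution and multiplication *)

Definition dual (v : seq bool) := rev (map negb v).

Lemma dual_cons b v : dual (b :: v) = dual v ++ [:: ~~ b].
Proof. by rewrite /dual /= rev_cons -cats1. Qed.

Lemma count_dual v : count id (dual v) = count negb v.
Proof. by rewrite /dual count_rev count_map. Qed.

Lemma head_dual v : head true (dual v) = ~~ last false v.
Proof.
rewrite /dual; case/lastP: v => [|v b] //.
by rewrite map_rcons rev_rcons last_rcons.
Qed.

(** The real part descends from c to c - e n, n being the number of b's, and stays right of - 1 /
    omega. The last condition excludes a multiplication on the line through 0, where [weight] has a
    pole. *)
Lemma admissible_line (e c : R) v : 0 < e -> c <= 0 ->
  omega * (e * (count id v)%:R - c) < 1 -> (c < 0) || head true v ->
  admissible e c v.
Proof.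
move=> e0; elim: v c => [|[] v ih] c //=.
- move=> c0 h _; apply: ih; first by lra.
    by move: h; rewrite natr_true; congr (_ < _); ring.
  by apply/orP; left; lra.
- rewrite add0n orbF => c0 h cn; split; last by apply: ih => //; rewrite cn.
  have n0 : 0 <= e * (count id v)%:R by rewrite mulr_ge0 // ltW.
  rewrite normrM gtr0_norm // ltr0_norm //.
  apply/andP; split; first by rewrite mulr_gt0 // oppr_gt0.
  by have : 0 <= omega * (e * (count id v)%:R); [rewrite mulr_ge0 // ltW | lra].
Qed.

Lemma wave_sym s p : wave s p = wave p s.
Proof. by rewrite /wave mulrAC. Qed.

Lemma waveD s p a : wave s (p + a) = wave s p * wave s a.
Proof. by rewrite /wave mulrDr opprD cexpD. Qed.

Lemma wave0 p : wave 0 p = 1.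
Proof. by rewrite /wave mulr0 mul0r oppr0 cexp0. Qed.

Lemma normc_wave (sg y c x : R) : normc (wave (sg +i* y) (c +i* x)) =
  expR (- (- (2 * pi * omega * sg) * x)) * expR (- (- (2 * pi * omega * c) * y)).
Proof. by rewrite /wave normc_cexp -expRD; congr expR; rewrite /=; ring. Qed.

(** By the symmetry of the wave, each real part fixes the rate in the other variable; both rates are
    positive when sg and c are negative. *)
Lemma exp_dominated_wave (sg y c : R) :
  exp_dominated (- (2 * pi * omega * sg)) (- (2 * pi * omega * c)) c
    (fun p y' => wave (sg +i* (y + y')) p).
Proof.
split.
  apply: cmeasurable_cexp; apply: cmeasurableN; apply: cmeasurableM.
    apply: cmeasurableM; first exact: cmeasurable_cst.
    apply: cmeasurable_complex; first exact: measurable_cst.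
    by apply: measurable_funD; [exact: measurable_cst|exact: measurable_snd].
  by apply: cmeasurable_complex; [exact: measurable_cst|exact: measurable_fst].
exists (expR (2 * pi * omega * c * y)); first exact: expR_ge0.
move=> x y'; rewrite normc_wave.
have -> : - (- (2 * pi * omega * c) * (y + y')) =
  2 * pi * omega * c * y + - (- (2 * pi * omega * c) * y') by ring.
by rewrite [X in _ * X <= _]expRD mulrCA.
Qed.

Lemma kern_wave (e sg y : R) p : 0 < e < 1 -> 0 < - (omega * sg) < 1 ->
  line_integral e (fun a => kern a * wave (sg +i* y) (p + a)) =
  weight (sg +i* y) * wave (sg +i* y) p.
Proof.
move=> he /andP[s0 s1]; set s := sg +i* y.
(* With this c the wave is exp (c p), and the hypothesis on sg says that Im c lies in ]0, 2 pi[, the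
   range of [kern_transform_value]. *)
pose c := - (two_pi_i * omega%:C * s).
have cim : 0 < complex.Im c < 2 * pi.
  have -> : complex.Im c = 2 * pi * - (omega * sg) by rewrite /c /=; ring.
  by have := @pi_gt0 R => p0; apply/andP; split; nra.
have ws a : wave s a = cexp (c * a) by rewrite /wave /c mulNr.
rewrite weightE -/c -(kern_transform_value cim he) [RHS]mulrC mulrCA.
rewrite -cintegralZ; last exact: (kern_transform_integrable cim).
congr (_ * _); apply: eq_cintegral => x.
by rewrite waveD mulrCA -ws.
Qed.

(** A leading b integrates the induction hypothesis over the line c - e; Fubini carries this
    integral through [dual v] to the wave, where [kern_wave] turns it into the final a of the dual.
    A leading a is a scalar; carried inside, it becomes by the same identity, now on the contour f,
    a final b. *)
Lemma op_duality (e f c y : R) v : 0 < e < 1 -> 0 < f < 1 ->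
  c <= 0 -> omega * (e * (count id v)%:R - c) < 1 ->
  omega * (f * (count negb v)%:R) < 1 ->
  (c < 0) || head true v -> ~~ last false v ->
  op e v (fun=> 1) (c +i* y) = op f (dual v) (wave (c +i* y)) 0.
Proof.
move=> he hf; have /andP[e0 e1] := he; have /andP[f0 f1] := hf.
have p0 := @pi_gt0 R; have o0 := omega_gt0.
elim: v c y => [|[] v ih] c y.
- by move=> *; rewrite -[RHS]/(wave (c +i* y) 0) wave_sym wave0.
- move=> c0 h1 h2 _ lv.
  have vf : ~~ last false v by case: v lv {ih h1 h2}.
  (* The word ends with a, so [dual v] contains a convolution and evaluates the wave on the line -
     nf strictly left of 0. *)
  have nM : (0 < count negb v)%N.
    case/lastP: v lv {ih h1 h2 vf} => // v b; rewrite last_cons last_rcons => b0.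
    by rewrite -cats1 count_cat /= b0 addnC.
  have nM1 : 1 <= (count negb v)%:R :> R by rewrite ler1n.
  have n0 : 0 <= e * (count id v)%:R by rewrite mulr_ge0 // ltW.
  have h1' : omega * (e * (count id v)%:R - (c - e)) < 1.
    by move: h1; rewrite /= natr_true; congr (_ < _); ring.
  have h2' : omega * (f * (count negb v)%:R) < 1 by move: h2; rewrite /= add0n.
  have ce : c - e < 0 by lra.
  pose nf := f * (count negb v)%:R.
  have nf0 : 0 < nf by rewrite mulr_gt0 // ltr0n.
  have hm : 0 < - (2 * pi * omega * (c - e)) < 2 * pi.
    have : omega * (e - c) < 1 by nra.
    have : 0 < omega * (e - c) by rewrite mulr_gt0 //; lra.
    move=> q1 q2; have -> : - (2 * pi * omega * (c - e)) = 2 * pi * (omega * (e - c)) by ring.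
    by apply/andP; split; nra.
  have hk : 0 < - (2 * pi * omega * (0 - nf)) < 2 * pi.
    have : 0 < omega * nf by rewrite mulr_gt0.
    move: h2'; rewrite -/nf => q1 q2.
    have -> : - (2 * pi * omega * (0 - nf)) = 2 * pi * (omega * nf) by ring.
    by apply/andP; split; nra.
  have av : admissible f 0 (dual v).
    apply: admissible_line => //; first by rewrite count_dual subr0.
    by rewrite head_dual vf orbT.
  have gw : exp_dominated (- (2 * pi * omega * (c - e))) (- (2 * pi * omega * (0 - nf)))
      (0 - f * (count id (dual v))%:R) (fun p y' => wave ((c - e) +i* (y + y')) p).
    by rewrite count_dual; exact: exp_dominated_wave.
  rewrite op_true dual_cons op_cat.
  have -> : cintegral (fun x' => kern ((- e) +i* x') * op e v (fun=> 1) ((c - e) +i* (y + x'))) =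
    cintegral (fun x' => kern ((- e) +i* x') *
       op f (dual v) (wave ((c - e) +i* (y + x'))) (0 +i* 0)).
    by apply: eq_cintegral => x'; rewrite ih ?ce // ltW.
  (* Only the values on the line - nf matter now. There the integration variable sits in the first
     argument of the wave; symmetry moves it to the second, as [kern_wave] expects. *)
  rewrite -(op_swap 0 hf he hm hk av gw); apply: eq_op_line => x.
  rewrite count_dual -/nf /=.
  under eq_cintegral do rewrite -addc_line wave_sym.
  rewrite -[LHS]/(line_integral e (fun t => kern t * wave ((0 - nf) +i* x) ((c +i* y) + t))).
  have hx : 0 < - (omega * (0 - nf)) < 1.
    by move: h2'; rewrite -/nf sub0r mulrN opprK => ->; rewrite mulr_gt0.
  by rewrite (kern_wave _ _ he hx) wave_sym.
- rewrite /= orbF => c0 h1 h2 cn lv.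
  have {}h1 : omega * (e * (count id v)%:R - c) < 1 by [].
  have n0 : 0 <= e * (count id v)%:R by rewrite mulr_ge0 // ltW.
  have h2' : omega * (f * (count negb v)%:R) < 1.
    by move: h2; rewrite natr_true; nra.
  have sgc : 0 < - (omega * c) < 1 by apply/andP; split; nra.
  have hm : 0 < - (2 * pi * omega * c) < 2 * pi.
    have -> : - (2 * pi * omega * c) = 2 * pi * - (omega * c) by ring.
    by move: sgc => /andP[q1 q2]; apply/andP; split; nra.
  have av : admissible f 0 (dual v).
    apply: admissible_line => //; first by rewrite count_dual subr0.
    by rewrite head_dual lv orbT.
  have gw : exp_dominated (- (2 * pi * omega * c)) 0 (0 - f * (count id (dual v))%:R)
      (fun p _ => wave (c +i* y) p).
    split.
      apply: cmeasurable_cexp; apply: cmeasurableN; apply: cmeasurableM.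
        exact: cmeasurable_cst.
      by apply: cmeasurable_complex; [exact: measurable_cst|exact: measurable_fst].
    set d := 0 - _; exists (expR (- (- (2 * pi * omega * d) * y))).
      exact: expR_ge0.
    by move=> x y'; rewrite normc_wave mul0r oppr0 expR0 mulr1 mulrC.
  rewrite ih ?cn // dual_cons op_cat.
  (* Here [kern_wave] is read backwards: the scalar [weight (c +i* y)] is created by a convolution
     along f. *)
  have -> : op f [:: ~~ false] (wave (c +i* y)) = fun p => weight (c +i* y) * wave (c +i* y) p.
    by apply/funext => p; rewrite /= kern_wave.
  by rewrite -(op_scale 0 _ hf hm av gw).
Qed.

End WordOperators.

(** * Duality *)

Definition letters (u : seq nat) : seq bool :=
  flatten [seq true :: nseq k false | k <- u].

(** Counts the factors hbar in the product of the values of I_omega: one for the letter hbar b, k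
    for b a^k. *)
Definition hbar_degree (u : seq nat) : nat := sumn [seq maxn k 1 | k <- u].

Lemma letters_cons k u : letters (k :: u) = true :: (nseq k false ++ letters u).
Proof. by []. Qed.

Lemma letters_cat u v : letters (u ++ v) = letters u ++ letters v.
Proof. by rewrite /letters map_cat flatten_cat. Qed.

Lemma count_letters u : count id (letters u) = size u.
Proof.
elim: u => //= k u ih; rewrite -/(letters u) count_cat ih add1n; congr _.+1.
by rewrite count_nseq mul0n.
Qed.

(** The default [true] stands for the b that opens the letter k, which would be last if nothing
    followed. *)
Lemma last_letters k u : last 1%N (k :: u) != 0%N ->
  ~~ last true (nseq k false ++ letters u).
Proof.
elim: u k => [|l u ih] k.
  by case: k => // k _; rewrite cats0; elim: k.
by move=> h; rewrite last_cat /=; exact: ih.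
Qed.

(** * From multiple integrals to operators *)

Section WordIntegral.
Context {R : realType}.
Variable omega : R.
Hypothesis omega_gt0 : 0 < omega.
Let hbar : R[i] := two_pi_i * omega%:C.

Lemma I_weight k s :
  I_ omega k s = hbar ^+ maxn k 1 * weight omega s ^+ k.
Proof. by case: k => [|k]; rewrite /I_ ?expr0 ?mulr1 // exprMn weightE. Qed.

Lemma op_nseq_false e k v H s :
  op omega e (nseq k false ++ v) H s = weight omega s ^+ k * op omega e v H s.
Proof.
by elim: k => [|k ih]; rewrite ?expr0 ?mul1r //= ih exprS mulrA.
Qed.

(** The constant 1 has no decay along the contour; splitting off the last a of the word replaces it
    by [weight], which has. *)
Lemma op_one_integrable (e c y : R) v : 0 < e < 1 -> c <= 0 ->
  omega * (e * (count id (true :: v))%:R - c) < 1 -> ~~ last true v ->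
  cintegrable (fun x => kern ((- e) +i* x) * op omega e v (fun=> 1) ((c - e) +i* (y + x))).
Proof.
move=> he c0; have /andP[e0 e1] := he; rewrite /= natr_true.
case/lastP: v => // v b; rewrite last_rcons => h /negbTE b0.
move: h; rewrite b0 -cats1 count_cat /= addn0 => h.
under eq_fun do rewrite op_cat /=.
have p0 := @pi_gt0 R; have o0 := omega_gt0.
(* A positive rate below 2 pi, as convolution requires, and below 2 pi omega, the decay of
   [weight]. *)
pose m := pi * Num.min 1 omega.
have m0 : 0 < Num.min 1 omega by rewrite lt_min ltr01.
have m1 : Num.min 1 omega <= 1 by rewrite ge_min lexx.
have m2 : Num.min 1 omega <= omega by rewrite ge_min lexx orbT.
have hm : 0 < m < 2 * pi by rewrite /m; apply/andP; split; nra.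
have n0 : 0 <= e * (count id v)%:R by rewrite mulr_ge0 // ltW.
have h' : omega * (e * (count id v)%:R - (c - e)) < 1.
  by move: h; congr (_ < _); ring.
have av : admissible omega e (c - e) v.
  by apply: admissible_line => //; [lra | apply/orP; left; lra].
set d := c - e - e * (count id v)%:R.
have hd : 0 < `|omega * d| < 1.
  have d0 : d < 0 by rewrite /d; lra.
  rewrite normrM gtr0_norm // ltr0_norm // mulr_gt0 ?oppr_gt0 //=.
  by move: h'; congr (_ < _); rewrite /d; ring.
have [|K K0 HK] := @weight_decay R omega d m hd.
  by rewrite /m; apply/andP; split; nra.
have gW : exp_dominated m 0 d (fun s _ => weight omega s * 1).
  split.
    apply: cmeasurableM; last exact: cmeasurable_cst.
    exact: (cmeasurable_comp (cmeasurable_weight omega d) (@measurable_fst _ _ R R)).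
  by exists K => // x y'; rewrite mulr1 mul0r oppr0 expR0 mulr1.
have gv := op_exp_dominated omega_gt0 he hm av gW.
exact: (exp_dominated_kern_integrable y 0 he hm gv).
Qed.

(** Peeling off the outermost variable shifts the partial sum and leaves a factor independent of the
    inner variables, hence the general starting point c +i* y and the factor a. *)
Lemma multi_integral_op (e c y : R) (a : R[i]) u : 0 < e < 1 -> c <= 0 ->
  omega * (e * (size u)%:R - c) < 1 -> last 1%N u != 0%N ->
  multi_integral e (size u) (fun t => a *
    ((\prod_(j < size u) (cexp (two_pi_i * t`_j) - 1)^-1) *
     (\prod_(j < size u) I_ omega (nth 0%N u j) ((c +i* y) + \sum_(l < j.+1) t`_l)))) =
  a * (hbar ^+ hbar_degree u * op omega e (letters u) (fun=> 1) (c +i* y)).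
Proof.
move=> he; have /andP[e0 e1] := he.
elim: u c y a => [|k u ih] c y a c0 h lu.
  by rewrite /= !big_ord0 expr0 !mulr1.
have h' : omega * (e * (size u)%:R - (c - e)) < 1.
  by move: h; rewrite /= -natr1; congr (_ < _); ring.
have lu' : last 1%N u != 0%N by case: u lu {ih h h'}.
pose A : R[i] := a * hbar ^+ hbar_degree (k :: u).
have step x : multi_integral e (size u) (fun ts => a *
    ((\prod_(j < (size u).+1) (cexp (two_pi_i * (((- e) +i* x) :: ts)`_j) - 1)^-1) *
     (\prod_(j < (size u).+1) I_ omega (nth 0%N (k :: u) j)
        ((c +i* y) + \sum_(l < j.+1) (((- e) +i* x) :: ts)`_l)))) =
   A * (kern ((- e) +i* x) *
     op omega e (nseq k false ++ letters u) (fun=> 1) ((c - e) +i* (y + x))).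
  set t := (- e) +i* x.
  transitivity (multi_integral e (size u) (fun ts =>
     (a * (kern t * I_ omega k ((c - e) +i* (y + x)))) *
     ((\prod_(j < size u) (cexp (two_pi_i * ts`_j) - 1)^-1) *
      (\prod_(j < size u) I_ omega (nth 0%N u j)
         (((c - e) +i* (y + x)) + \sum_(l < j.+1) ts`_l))))).
    congr (multi_integral _ _ _); apply/funext => ts.
    rewrite !big_ord_recl /= big_ord0 addr0.
    have -> : \prod_(i < size u) I_ omega (nth 0%N u i)
        (c +i* y + \sum_(l < (bump 0 i).+1) (t :: ts)`_l) =
      \prod_(j < size u) I_ omega (nth 0%N u j)
         (((c - e) +i* (y + x)) + \sum_(l < j.+1) ts`_l).
      apply: eq_bigr => j _; rewrite big_ord_recl /= addrA; congr (I_ _ _ (_ + _)).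
    rewrite -/(kern t) -addc_line -/t; ring.
  rewrite ih //; last by lra.
  rewrite I_weight op_nseq_false /A /hbar_degree /= exprD; ring.
rewrite /=.
transitivity (line_integral e (fun t => A * (kern t *
    op omega e (nseq k false ++ letters u) (fun=> 1) ((c +i* y) + t)))).
  by congr (_ * _); apply: eq_cintegral => x; rewrite -step.
rewrite /line_integral cintegralZ.
  by rewrite /A -!mulrA mulrCA; congr (_ * _); rewrite mulrCA.
apply: op_one_integrable => //; last exact: last_letters.
by rewrite -letters_cons count_letters.
Qed.

Lemma Z_word_op eps u : (0 < size u)%N ->
  0 < eps (size u) < Num.min 1 (1 / ((size u)%:R * omega)) -> last 1%N u != 0%N ->
  Z_word eps omega u =
  hbar ^+ hbar_degree u * op omega (eps (size u)) (letters u) (fun=> 1) 0.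
Proof.
move=> u0; rewrite lt_min => /and3P[e0 e1 e2] lu.
have n0 : 0 < (size u)%:R :> R by rewrite ltr0n.
have h : omega * (eps (size u) * (size u)%:R - 0) < 1.
  move: e2; rewrite ltr_pdivlMr ?mulr_gt0 // => e2.
  by rewrite subr0; have -> : omega * (eps (size u) * (size u)%:R) =
    eps (size u) * ((size u)%:R * omega) by ring.
have he : 0 < eps (size u) < 1 by rewrite e0.
have := multi_integral_op 0 1 he (lexx 0) h lu.
rewrite mul1r => <-; rewrite /Z_word; congr (multi_integral _ _ _).
apply/funext => t; rewrite mul1r; congr (_ * _); apply: eq_bigr => j _.
by rewrite add0r.
Qed.

(** * The involution on words made of blocks *)

Definition block_word (s : seq (nat * nat)) : seq nat :=
  flatten [seq rcons (nseq p.1 0%N) p.2.+1 | p <- s].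

Definition swap_rev (s : seq (nat * nat)) := rev [seq (p.2, p.1) | p <- s].

Lemma M0_elt_letters s : M0_elt s = \prod_(k <- block_word s) letter k.
Proof.
elim: s => [|[al be] s ih]; first by rewrite big_nil M0_elt_nil.
rewrite M0_elt_cons /block_word /= big_cat big_rcons big_nseq iter_mulr_1 /=.
exact: (congr1 (fun z => _ * z) ih).
Qed.

Lemma block_word_cat s t : block_word (s ++ t) = block_word s ++ block_word t.
Proof. by rewrite /block_word map_cat flatten_cat. Qed.

Lemma block_word_cons p s : block_word (p :: s) = block_word [:: p] ++ block_word s.
Proof. by rewrite -block_word_cat. Qed.

Lemma swap_rev_cons p s : swap_rev (p :: s) = swap_rev s ++ [:: (p.2, p.1)].
Proof. by rewrite /swap_rev /= rev_cons -cats1. Qed.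

Lemma letters_nseq0 n : letters (nseq n 0%N) = nseq n true.
Proof. by elim: n => // n ih; rewrite [nseq n.+1 0%N]/= letters_cons ih. Qed.

Lemma block_word1 p : block_word [:: p] = nseq p.1 0%N ++ [:: p.2.+1].
Proof. by rewrite /block_word /= cats0 cats1. Qed.

Lemma letters_block p : letters (block_word [:: p]) =
  nseq p.1.+1 true ++ nseq p.2.+1 false.
Proof.
rewrite block_word1 letters_cat.
rewrite letters_nseq0.
by rewrite /letters /= cats0 -[true :: _]/(nseq 1 true ++ _) catA -nseqD addn1.
Qed.

Lemma dual_cat v w : dual (v ++ w) = dual w ++ dual v.
Proof. by rewrite /dual map_cat rev_cat. Qed.

(** A block (hbar b)^alpha b a^(beta + 1) reads b^(alpha + 1) a^(beta + 1), so reversing and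
    exchanging a and b swaps its exponents: up to powers of hbar, [dual] is sigma. *)
Lemma dual_letters s : dual (letters (block_word s)) = letters (block_word (swap_rev s)).
Proof.
elim: s => // p s ih; rewrite swap_rev_cons block_word_cat letters_cat -ih.
rewrite -cat1s block_word_cat letters_cat dual_cat; congr (_ ++ _).
by rewrite !letters_block dual_cat /dual !map_nseq !rev_nseq.
Qed.

Lemma hbar_degree_cat u v : hbar_degree (u ++ v) = (hbar_degree u + hbar_degree v)%N.
Proof. by rewrite /hbar_degree map_cat sumn_cat. Qed.

(** Each block has degree alpha + beta + 1. *)
Lemma hbar_degree_swap_rev s : hbar_degree (block_word (swap_rev s)) =
  hbar_degree (block_word s).
Proof.
elim: s => // p s ih.
rewrite swap_rev_cons block_word_cat hbar_degree_cat ih (block_word_cons p).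
rewrite hbar_degree_cat addnC; congr addn; rewrite !block_word1 !hbar_degree_cat /hbar_degree.
rewrite !map_nseq !sumn_nseq /= !maxnSS !maxn0 !addn0 !mul1n.
by rewrite !addnS addnC.
Qed.

Lemma last_block_word s : last 1%N (block_word s) != 0%N.
Proof.
case/lastP: s => // s p; rewrite -cats1 block_word_cat last_cat /block_word /= cats0.
by rewrite last_rcons.
Qed.

Lemma size_block_word_gt0 p s : (0 < size (block_word (p :: s)))%N.
Proof. by rewrite /block_word /= size_cat size_rcons. Qed.

(** The two words may differ in length, hence two contours e and f; [op_duality] is applied at the
    point 0, where the wave is the constant 1. *)
Lemma Z_word_swap_rev eps s :
  (forall r : nat, (0 < r)%N -> 0 < eps r < Num.min 1 (1 / (r%:R * omega))) ->
  Z_word eps omega (block_word (swap_rev s)) = Z_word eps omega (block_word s).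
Proof.
move=> heps; case: s => // p s; set t := p :: s.
have t0 : (0 < size (block_word t))%N by exact: size_block_word_gt0.
have s0 : (0 < size (block_word (swap_rev t)))%N.
  rewrite /t swap_rev_cons block_word_cat size_cat addn_gt0 orbC.
  by rewrite size_block_word_gt0.
rewrite !Z_word_op ?last_block_word ?heps // hbar_degree_swap_rev; congr (_ * _).
have /andP[e0] := heps _ t0; rewrite lt_min => /andP[e1 e2].
have /andP[f0] := heps _ s0; rewrite lt_min => /andP[f1 f2].
set e := eps _ in e0 e1 e2; set f := eps _ in f0 f1 f2 *.
have n0 : 0 < (size (block_word t))%:R :> R by rewrite ltr0n.
have m0 : 0 < (size (block_word (swap_rev t)))%:R :> R by rewrite ltr0n.
rewrite ltr_pdivlMr ?mulr_gt0 // in e2; rewrite ltr_pdivlMr ?mulr_gt0 // in f2.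
have cn : count negb (letters (block_word t)) = size (block_word (swap_rev t)).
  by rewrite -count_dual dual_letters count_letters.
have he : 0 < e < 1 by rewrite e0.
have hf : 0 < f < 1 by rewrite f0.
have := @op_duality R omega omega_gt0 e f 0 0 (letters (block_word t)) he hf (lexx 0).
rewrite cn count_letters dual_letters => ->.
- by congr (op _ _ _ _ _); apply/funext => q; rewrite wave0.
- by rewrite subr0 mulrCA (mulrC omega).
- by rewrite mulrCA (mulrC omega).
- by case: (block_word t) t0 => // k u _; rewrite orbT.
- case: (block_word t) t0 (last_block_word t) => // k u _ lu.
  exact: last_letters lu.
Qed.

End WordIntegral.

Theorem theorem4p3 (R : realType) (omega : R) (homega : 0 < omega < 2)
    (eps : nat -> R)
    (heps : forall r : nat, (0 < r)%N ->
       0 < eps r < Num.min 1 (1 / (r%:R * omega)))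
    (w : frakH) (hw : hatH0 w) :
  Z_omega eps omega (sigmaH w) = Z_omega eps omega w.
Proof.
have /andP[ o0 _] := homega; have on0 : omega != 0 by rewrite gt_eqF.
have [s sM ws] := hw; have [_ es] := sigmaH_hatH0 hw.
(* [extend] is injective, so [sigmaH w] equals any explicit preimage of [sigma (extend w)]; one is
   built along the linear combination. *)
suff [w' [ew Zw]] : exists w', extend w' = sigma (extend w) /\
    Z_omega eps omega w' = Z_omega eps omega w.
  by rewrite (extend_inj (etrans es (esym ew))).
rewrite {hw es}ws; elim: s sM => [|[c x] s ih] sM.
  by exists 0; rewrite big_nil extend0 sigma0.
have [|w' [ew Zw]] := ih; first by move=> d ds; apply: sM; rewrite inE ds orbT.
have [t /= xt] := sM (c, x) (mem_head _ _).
exists (c *: M0_elt (swap_rev t) + w'); rewrite big_cons /= xt; split.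
  rewrite [in LHS]extendD [in RHS]extendD [in RHS]sigmaD ew [in LHS]extendZ.
  rewrite [in RHS]extendZ [in RHS]sigmaZ.
  exact: (congr1 (fun z => _ *: z + _) (esym (sigma_M0_elt t))).
apply: etrans (Z_omega_is_linear _ _ _ _ _) _.
apply: etrans _ (esym (Z_omega_is_linear _ _ _ _ _)).
have ZM r : Z_omega eps omega (M0_elt r) = Z_word eps omega (block_word r).
  exact: etrans (congr1 _ (M0_elt_letters r)) (Z_omega_letters eps _ on0).
have Zt := etrans (ZM _) (etrans (Z_word_swap_rev o0 t heps) (esym (ZM t))).
exact: (congr2 (fun y z => _ * y + z) Zt Zw).
Qed.
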